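(* Let $W_\Gamma$ be an infinite Coxeter group associated to a Coxeter graph $\Gamma$. Suppose that at least one of the following holds: (1) $\mathrm{Out}(W_\Gamma)$ is finite; (2) $\Gamma$ is disconnected; (3) there exist two (distinct) non-adjacent even vertices in $\Gamma$; (4) there exists an infinite special parabolic subgroup $W_\Omega$ (with $\Omega\subseteq\Gamma$ a full subgraph) such that (a) $\mathrm{Out}(W_\Omega)$ is finite and (b) all edges in $E(\Gamma)$ with one vertex in $V(\Omega)$ and the other vertex in $V(\Gamma)-V(\Omega)$ have even labels. Then $\mathrm{Aut}(W_\Gamma)$ does not have Kazhdan's property (T).
   Context: A Coxeter graph is a finite simplicial graph $\Gamma$ with vertex set $V(\Gamma)$, edge set $E(\Gamma)$ (a set of two-element subsets of $V(\Gamma)$) and an edge-labeling $\varphi\colon E(\Gamma)\to\{2,3,4,\ldots\}$. The associated Coxeter group is $$W_\Gamma=\langle V(\Gamma)\mid v^2 \text{ for all } v\in V(\Gamma),\ (vw)^{\varphi(\{v,w\})}\text{ for all }\{v,w\}\in E(\Gamma)\rangle$$ (there is no relation between $v$ and $w$ when they are not adjacent). A full subgraph $\Lambda\subseteq\Gamma$ is one that contains every edge of $\Gamma$ between its vertices. For such $\Lambda$ the subgroup of $W_\Gamma$ generated by $V(\Lambda)$ is canonically isomorphic to the Coxeter group $W_\Lambda$ (with the restricted labeling), is denoted $W_\Lambda$, and is called a special parabolic subgroup. A vertex $v\in V(\Gamma)$ is called even if every edge $e\in E(\Gamma)$ with $v\in e$ has an even label. A countable group $G$ has Kazhdan's property (T)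 if every action of $G$ on a real Hilbert space by (affine) isometries has a global fixed point. *)

(* Defs.v *)
From HB Require Import structures.
From mathcomp Require Import all_boot all_order all_algebra.
From mathcomp Require Import all_classical all_reals all_analysis.
Import numFieldNormedType.Exports.

Set Implicit Arguments.
Unset Strict Implicit.
Unset Printing Implicit Defensive.

Local Open Scope classical_set_scope.
Local Open Scope quotient_scope.
Local Open Scope group_scope.

(* A letter [(x, true)] stands for [x] and [(x, false)] for its inverse. *)
Definition word (X : Type) := seq (X * bool).

HB.instance Definition _ (X : choiceType) := Choice.on (word X).

Section Presentation.
Variables (X : choiceType) (rels : set (word X)).
Implicit Types u v w : word X.

Inductive word_eq : word X -> word X -> Prop :=
| word_eq_refl u : word_eq u u
| word_eq_sym u v : word_eq u v -> word_eq v u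
| word_eq_trans u v w : word_eq u v -> word_eq v w -> word_eq u w
| word_eq_cancel u v x b :
    word_eq (u ++ [:: (x, b); (x, ~~ b)] ++ v) (u ++ v)
| word_eq_relator u v r : rels r -> word_eq (u ++ r ++ v) (u ++ v).

Definition word_eqb : rel (word X) := fun u v => `[< word_eq u v >].

Lemma word_eqb_refl : reflexive word_eqb.
Proof. by move=> u; apply/asboolP; exact: word_eq_refl. Qed.

Lemma word_eqb_sym : symmetric word_eqb.
Proof. by move=> u v; apply/asboolP/asboolP; exact: word_eq_sym. Qed.

Lemma word_eqb_trans : transitive word_eqb.
Proof.
by move=> v u w /asboolP uv /asboolP vw; apply/asboolP; exact: word_eq_trans vw.
Qed.

Canonical word_equiv :=
  EquivRel word_eqb word_eqb_refl word_eqb_sym word_eqb_trans.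

Definition presented := {eq_quot word_equiv}.

HB.instance Definition _ := Choice.on presented.

Definition class_of_word (w : word X) : presented := \pi_({eq_quot word_equiv}) w.

Definition presented_gen (x : X) : presented := class_of_word [:: (x, true)].

Definition word_inv (w : word X) : word X :=
  rev [seq (l.1, ~~ l.2) | l <- w].

Lemma class_of_wordP u v : class_of_word u = class_of_word v <-> word_eq u v.
Proof.
split; first by move=> /eqquotP /asboolP.
by move=> uv; apply/eqquotP/asboolP.
Qed.

Lemma class_of_word_repr (a : presented) : class_of_word (repr a) = a.
Proof. exact: reprK. Qed.

Lemma presented_ind (P : presented -> Prop) :
  (forall w, P (class_of_word w)) -> forall a, P a.
Proof. by move=> Pw a; rewrite -(class_of_word_repr a). Qed.

Lemma word_eq_catl w u v : word_eq u v -> word_eq (w ++ u) (w ++ v).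
Proof.
elim=> {u v} [u|u v _|u v t _ uv _ vt|u v x b|u v r rr].
- exact: word_eq_refl.
- exact: word_eq_sym.
- exact: word_eq_trans vt.
- by rewrite catA (catA w u v); exact: word_eq_cancel.
- by rewrite catA (catA w u v); exact: word_eq_relator.
Qed.

Lemma word_eq_catr w u v : word_eq u v -> word_eq (u ++ w) (v ++ w).
Proof.
elim=> {u v} [u|u v _|u v t _ uv _ vt|u v x b|u v r rr].
- exact: word_eq_refl.
- exact: word_eq_sym.
- exact: word_eq_trans vt.
- by rewrite -!catA; exact: word_eq_cancel.
- by rewrite -!catA; exact: word_eq_relator.
Qed.

Lemma word_eq_cat u u' v v' :
  word_eq u u' -> word_eq v v' -> word_eq (u ++ v) (u' ++ v').
Proof.
by move=> uu' vv'; apply: word_eq_trans (word_eq_catl u' vv'); exact: word_eq_catr.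
Qed.

Lemma word_invK : involutive word_inv.
Proof.
move=> w; rewrite /word_inv map_rev revK -map_comp -[RHS]map_id.
by apply: eq_map => -[x b] /=; rewrite negbK.
Qed.

Lemma word_eq_invr w : word_eq (w ++ word_inv w) [::].
Proof.
elim: w => [|[x b] w IHw]; first exact: word_eq_refl.
rewrite /word_inv /= rev_cons -/(word_inv w) -cats1 catA.
apply: (@word_eq_trans _ ([:: (x, b)] ++ [::] ++ [:: (x, ~~ b)])).
  rewrite -cat1s -!catA (catA w); apply: word_eq_catl; exact: word_eq_catr.
exact: (@word_eq_cancel [::] [::] x b).
Qed.

Lemma word_eq_invl w : word_eq (word_inv w ++ w) [::].
Proof. by rewrite -{2}[w]word_invK; exact: word_eq_invr. Qed.

Definition presented_mul (a b : presented) : presented :=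
  class_of_word (repr a ++ repr b).

Definition presented_inv (a : presented) : presented :=
  class_of_word (word_inv (repr a)).

Lemma repr_class_of_word w : word_eq (repr (class_of_word w)) w.
Proof. by apply/class_of_wordP; rewrite class_of_word_repr. Qed.

Lemma class_of_word_cat u v :
  class_of_word (u ++ v) = presented_mul (class_of_word u) (class_of_word v).
Proof.
apply/class_of_wordP/word_eq_sym.
by apply: word_eq_cat; exact: repr_class_of_word.
Qed.

Fact presented_mulA : associative presented_mul.
Proof.
by elim/presented_ind=> u; elim/presented_ind=> v; elim/presented_ind=> w;
  rewrite -!class_of_word_cat catA.
Qed.

Fact presented_mul1 : left_id (class_of_word [::]) presented_mul.
Proof. by elim/presented_ind=> u; rewrite -class_of_word_cat. Qed.

Fact presented_mulr1 : right_id (class_of_word [::]) presented_mul.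
Proof. by elim/presented_ind=> u; rewrite -class_of_word_cat cats0. Qed.

Fact presented_mulV :
  left_inverse (class_of_word [::]) presented_inv presented_mul.
Proof.
move=> a; rewrite -{2}(class_of_word_repr a) -class_of_word_cat.
exact/class_of_wordP/word_eq_invl.
Qed.

Fact presented_mulrV :
  right_inverse (class_of_word [::]) presented_inv presented_mul.
Proof.
move=> a; rewrite -{1}(class_of_word_repr a) -class_of_word_cat.
exact/class_of_wordP/word_eq_invr.
Qed.

HB.instance Definition _ := isGroup.Build presented presented_mulA
  presented_mul1 presented_mulr1 presented_mulV presented_mulrV.

Lemma class_of_wordM u v :
  class_of_word (u ++ v) = class_of_word u * class_of_word v.
Proof. exact: class_of_word_cat. Qed.

Definition word_eval (H : groupType) (f : X -> H) (w : word X) : H :=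
  \prod_(l <- w) (if l.2 then f l.1 else (f l.1)^-1).

Lemma presented_lift (H : groupType) (f : X -> H) :
  (forall r, rels r -> word_eval f r = 1) ->
  exists F : presented -> H,
    {morph F : a b / a * b} /\ forall x, F (presented_gen x) = f x.
Proof.
have EM u v : word_eval f (u ++ v) = word_eval f u * word_eval f v.
  by rewrite /word_eval big_cat.
move=> fr; have E u v : word_eq u v -> word_eval f u = word_eval f v.
  elim=> {u v} [//|//|u v w _ -> _ -> //|u v x b|u v r rr].
    rewrite /word_eval big_cat /= !big_cons big_cat /=; congr (_ * _).
    by case: b => /=; rewrite ?mulVKg ?mulKg.
  by rewrite !EM (fr _ rr) (mul1g (word_eval f v)).
have EF w : word_eval f (repr (class_of_word w)) = word_eval f w.
  exact/E/repr_class_of_word.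
exists (fun a => word_eval f (repr a)); split=> [a b|x].
  by rewrite -{1}[a]class_of_word_repr -{1}[b]class_of_word_repr
    -class_of_wordM EF EM.
by rewrite EF /word_eval big_seq1.
Qed.

End Presentation.

Section GeneratedSubgroup.
Variables (G : groupType) (A : set G).

Definition is_subgroup (S : set G) : Prop :=
  [/\ S 1, forall x y, S x -> S y -> S (x * y) & forall x, S x -> S x^-1].

Definition in_generated : pred G := fun x => x \in smallest is_subgroup A.

Definition generated := {x : G | in_generated x}.

HB.instance Definition _ := SubChoice.on generated.

Fact generated_group_closed : group_closed in_generated.
Proof.
split; first by apply/mem_set => S [[]].
move=> x y /set_mem gx /set_mem gy; apply/mem_set => S [SG AS].
have [_ SM SV] := SG.
by apply: SM; [exact: gx|apply: SV; exact: gy].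
Qed.

HB.instance Definition _ :=
  SubChoice_isSubGroup.Build G in_generated generated generated_group_closed.

End GeneratedSubgroup.

Section Automorphisms.
Variable G : groupType.

Definition is_automorphism : pred (G -> G) :=
  fun f => `[< {morph f : x y / x * y} /\ bijective f >].

Definition Aut := {f : G -> G | is_automorphism f}.

HB.instance Definition _ := SubChoice.on Aut.

Implicit Types f g h : Aut.

Lemma AutM f : {morph val f : x y / x * y}.
Proof. by case: f => f /= /asboolP []. Qed.

Lemma Aut_bij f : bijective (val f).
Proof. by case: f => f /= /asboolP []. Qed.

Lemma AutP f g : (forall x, val f x = val g x) -> f = g.
Proof. by move=> fg; apply/val_inj/funext. Qed.

Fact Aut_one_subproof : is_automorphism idfun.
Proof. by apply/asboolP; split=> //; exists idfun. Qed.

Definition Aut_one : Aut := Sub idfun Aut_one_subproof.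

Fact Aut_mul_subproof f g : is_automorphism (val f \o val g).
Proof.
apply/asboolP; split; first by move=> x y /=; rewrite !AutM.
by apply: bij_comp; exact: Aut_bij.
Qed.

Definition Aut_mul f g : Aut := Sub (val f \o val g) (Aut_mul_subproof f g).

Fact Aut_inv_subproof f :
  exists g : Aut, cancel (val f) (val g) /\ cancel (val g) (val f).
Proof.
have [g fK gK] := Aut_bij f.
suff ga : is_automorphism g by exists (Sub g ga : Aut).
apply/asboolP; split; last by exists (val f).
by move=> x y; apply: (can_inj fK); rewrite AutM !gK.
Qed.

Definition Aut_inv f : Aut := projT1 (cid (Aut_inv_subproof f)).

Lemma Aut_invK f : cancel (val f) (val (Aut_inv f)).
Proof. exact: (projT2 (cid (Aut_inv_subproof f))).1. Qed.

Lemma Aut_invKV f : cancel (val (Aut_inv f)) (val f).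
Proof. exact: (projT2 (cid (Aut_inv_subproof f))).2. Qed.

Fact Aut_mulA : associative Aut_mul.
Proof. by move=> f g h; apply: AutP. Qed.

Fact Aut_mul1 : left_id Aut_one Aut_mul.
Proof. by move=> f; apply: AutP. Qed.

Fact Aut_mulr1 : right_id Aut_one Aut_mul.
Proof. by move=> f; apply: AutP. Qed.

Fact Aut_mulV : left_inverse Aut_one Aut_inv Aut_mul.
Proof. by move=> f; apply: AutP => x; exact: Aut_invK. Qed.

Fact Aut_mulrV : right_inverse Aut_one Aut_inv Aut_mul.
Proof. by move=> f; apply: AutP => x; exact: Aut_invKV. Qed.

HB.instance Definition _ := isGroup.Build Aut
  Aut_mulA Aut_mul1 Aut_mulr1 Aut_mulV Aut_mulrV.

Definition Inn : set Aut := [set f | exists g : G, forall x, val f x = g * x * g^-1].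

Lemma Inn1 : Inn 1.
Proof. by exists 1 => x; rewrite mul1g invg1 mulg1. Qed.

Lemma InnM f g : Inn f -> Inn g -> Inn (f * g).
Proof.
move=> [a fa] [b gb]; exists (a * b) => x.
by rewrite /= gb fa invgM !mulgA.
Qed.

Lemma InnV f : Inn f -> Inn f^-1.
Proof.
move=> [a fa]; exists a^-1 => x; apply: (can_inj (Aut_invK f)).
by rewrite (Aut_invKV f) fa invgK !mulgA mulgV mul1g mulgK.
Qed.

Lemma InnJ f g : Inn f -> Inn (g^-1 * f * g).
Proof.
move=> [a fa]; exists (val g^-1 a) => x.
apply: (can_inj (Aut_invK g)).
rewrite /= (Aut_invKV g) fa !AutM (Aut_invKV g); congr (_ * _).
apply: (mulgI a); rewrite mulgV -{1}(Aut_invKV g a) -AutM mulgV.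
by apply: (mulgI (val g 1)); rewrite mulg1 -AutM mulg1.
Qed.

Definition Inn_coset_eq : rel Aut := fun f g => `[< Inn (f^-1 * g) >].

Lemma Inn_coset_refl : reflexive Inn_coset_eq.
Proof. by move=> f; apply/asboolP; rewrite mulVg; exact: Inn1. Qed.

Lemma Inn_coset_sym : symmetric Inn_coset_eq.
Proof.
by move=> f g; apply/asboolP/asboolP => /InnV; rewrite invgM invgK.
Qed.

Lemma Inn_coset_trans : transitive Inn_coset_eq.
Proof.
move=> g f h /asboolP fg /asboolP gh; apply/asboolP.
by have := InnM fg gh; rewrite mulgA mulgK.
Qed.

Canonical Inn_coset_equiv :=
  EquivRel Inn_coset_eq Inn_coset_refl Inn_coset_sym Inn_coset_trans.

Definition Out := {eq_quot Inn_coset_equiv}.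

HB.instance Definition _ := Choice.on Out.

Definition Out_class f : Out := \pi_({eq_quot Inn_coset_equiv}) f.

Lemma Out_classP f g : Out_class f = Out_class g <-> Inn (f^-1 * g).
Proof.
split; first by move=> /eqquotP /asboolP.
by move=> fg; apply/eqquotP/asboolP.
Qed.

Lemma Out_class_repr (a : Out) : Out_class (repr a) = a.
Proof. exact: reprK. Qed.

Lemma Out_ind (P : Out -> Prop) : (forall f, P (Out_class f)) -> forall a, P a.
Proof. by move=> Pf a; rewrite -(Out_class_repr a). Qed.

Definition Out_mul (a b : Out) : Out := Out_class (repr a * repr b).

Definition Out_inv (a : Out) : Out := Out_class (repr a)^-1.

Lemma Out_classM f g : Out_class (f * g) = Out_mul (Out_class f) (Out_class g).
Proof.
apply/Out_classP.
have /Out_classP fi : Out_class f = Out_class (repr (Out_class f)).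
  by rewrite Out_class_repr.
have /Out_classP gi : Out_class g = Out_class (repr (Out_class g)).
  by rewrite Out_class_repr.
have := InnM (InnJ g fi) gi.
by rewrite invgM !mulgA mulgK.
Qed.

Lemma Out_classV f : Out_class f^-1 = Out_inv (Out_class f).
Proof.
apply/Out_classP; rewrite invgK.
have /Out_classP fi : Out_class f = Out_class (repr (Out_class f)).
  by rewrite Out_class_repr.
have := InnJ f^-1 (InnV fi).
by rewrite invgM !invgK !mulgA mulgK.
Qed.

Fact Out_mulA : associative Out_mul.
Proof.
by elim/Out_ind=> f; elim/Out_ind=> g; elim/Out_ind=> h;
  rewrite -!Out_classM mulgA.
Qed.

Fact Out_mul1 : left_id (Out_class 1) Out_mul.
Proof. by elim/Out_ind=> f; rewrite -Out_classM mul1g. Qed.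

Fact Out_mulr1 : right_id (Out_class 1) Out_mul.
Proof. by elim/Out_ind=> f; rewrite -Out_classM mulg1. Qed.

Fact Out_mulV : left_inverse (Out_class 1) Out_inv Out_mul.
Proof. by elim/Out_ind=> f; rewrite -Out_classV -Out_classM mulVg. Qed.

Fact Out_mulrV : right_inverse (Out_class 1) Out_inv Out_mul.
Proof. by elim/Out_ind=> f; rewrite -Out_classV -Out_classM mulgV. Qed.

HB.instance Definition _ := isGroup.Build Out
  Out_mulA Out_mul1 Out_mulr1 Out_mulV Out_mulrV.

End Automorphisms.

Local Open Scope ring_scope.

Record realHilbert (R : realType) := RealHilbert {
  hilbert_space :> completeNormedModType R;
  hilbert_dot : {dot hilbert_space for (@idfun R)};
  hilbert_normE : forall x : hilbert_space, `|x| ^+ 2 = hilbert_dot x x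
}.

Definition is_affine_map (R : realType) (H : realHilbert R) (f : H -> H) : Prop :=
  forall (t : R) (x y : H), f (t *: x + (1 - t) *: y) = t *: f x + (1 - t) *: f y.

Definition is_isometry (R : realType) (H : realHilbert R) (f : H -> H) : Prop :=
  forall x y : H, `|f x - f y| = `|x - y|.

Definition affine_isometric_action (R : realType) (G : groupType)
    (H : realHilbert R) (act : G -> H -> H) : Prop :=
  [/\ forall x, act 1%g x = x,
      forall g h x, act (g * h)%g x = act g (act h x)
    & forall g, is_affine_map (act g) /\ is_isometry (act g)].

Definition has_property_T (R : realType) (G : groupType) : Prop :=
  forall (H : realHilbert R) (act : G -> H -> H),
    affine_isometric_action act -> exists x : H, forall g : G, act g x = x.

(* [cox_label] is only meaningful on edges. *)
Record coxeter_graph := CoxeterGraph {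
  cox_vertex : finType;
  cox_edges : {set {set cox_vertex}};
  cox_label : {set cox_vertex} -> nat;
  cox_edges_card : forall e, e \in cox_edges -> #|e| = 2%N;
  cox_label_ge2 : forall e, e \in cox_edges -> (2 <= cox_label e)%N
}.

Section Coxeter.
Variable Gamma : coxeter_graph.
Local Notation V := (cox_vertex Gamma).
Implicit Types (v w : V) (A : {set V}).

Definition cox_adj : rel V := fun v w => [set v; w]%SET \in cox_edges Gamma.

Definition cox_relators : set (word V) :=
  [set r | (exists v, r = [:: (v, true); (v, true)]) \/
           (exists v w, cox_adj v w /\
              r = flatten (nseq (cox_label [set v; w]%SET)
                                [:: (v, true); (w, true)]))].

Definition coxeter_group := presented cox_relators.

HB.instance Definition _ := Group.on coxeter_group.

(* A full subgraph is determined by its set [A] of vertices; the parabolic is the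
   subgroup of the ambient group generated by [A]. *)
Definition special_parabolic A : groupType :=
  generated [set (presented_gen cox_relators v : coxeter_group) | v in [set` A]].

Definition cox_connected : Prop := forall v w, connect cox_adj v w.

Definition even_vertex v : Prop :=
  forall e, e \in cox_edges Gamma -> v \in e -> ~~ odd (cox_label e).

End Coxeter.

(* Main.v *)
Require Import Defs.
From HB Require Import structures.
From mathcomp Require Import all_boot all_order all_algebra.
From mathcomp Require Import all_classical all_reals all_analysis.
From mathcomp Require Import ring lra zify.
Import Order.TTheory GRing.Theory Num.Theory numFieldNormedType.Exports.

(* If a group [G] acts on a set [Y] and [A] is a subset of [Y] differing from each
   of its translates by finitely many points, then [f |-> g f + 1_{gA} - 1_A] is an
   affine isometric action of [G] on [l^2(Y)]; it has no fixed point as soon as some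
   orbit meets both [A] and its complement in infinite sets. Such actions can be
   induced from a subgroup of finite index.

   For a Coxeter group [W] the relations allow one to define the parity with which a
   word crosses the wall of a reflection. The resulting cocycle makes [W], hence any
   subgroup generated by a set of vertices, act on (reflections) x {sides of the wall}
   in the above way; restricted to an infinite conjugacy class of reflections, the
   centre acts trivially.

   An involution of minimal length in its conjugacy class is determined by its
   descent set, so [W] has finitely many classes of involutions and a subgroup of
   finite index in [Aut W] maps every vertex to a conjugate of itself. It preserves
   the kernel of the retraction onto [W_Omega] in case (4), and of a quotient of [W]
   onto the infinite dihedral group in cases (2) and (3). In each case a subgroup of
   finite index in [Aut W] acts on the quotient by inner automorphisms, hence on the
   walls of [W_Omega], respectively on the half-lines of the integers. *)

Set Implicit Arguments.
Unset Strict Implicit.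
Unset Printing Implicit Defensive.

Local Open Scope classical_set_scope.

(** * Square-summable functions *)

Section NonnegSummable.
Local Open Scope ring_scope.
Variables (R : realType) (Y : choiceType).
Implicit Types h : Y -> R.

Definition nnsummable h :=
  (forall y, 0 <= h y) /\ (\esum_(y in [set: Y]) (h y)%:E < +oo)%E.

Definition nnsum h : R := fine (\esum_(y in [set: Y]) (h y)%:E).

Lemma nnsumE h : nnsummable h ->
  (\esum_(y in [set: Y]) (h y)%:E)%E = (nnsum h)%:E.
Proof.
move=> [h0 hoo]; rewrite fineK// ge0_fin_numE//.
by apply: esum_ge0 => y _; rewrite lee_fin.
Qed.

Lemma nnsum_ge0 h : (forall y, 0 <= h y) -> 0 <= nnsum h.
Proof. by move=> h0; apply/fine_ge0/esum_ge0 => y _; rewrite lee_fin. Qed.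

(** The extended sum is the supremum of the finite partial sums, so one real bound on these gives
    summability and bounds the sum. *)
Lemma nnsummableP h : (forall y, 0 <= h y) ->
  forall M : R, (forall s : seq Y, uniq s -> \sum_(y <- s) h y <= M) ->
  nnsummable h /\ nnsum h <= M.
Proof.
move=> h0 M hM.
have leM : (\esum_(y in [set: Y]) (h y)%:E <= M%:E)%E.
  apply: ge_ereal_sup => _ [X [finX _] <-].
  rewrite fsbig_finite//= sumEFin lee_fin; apply: hM; exact: finmap.fset_uniq.
have nh : nnsummable h by split=> //; rewrite (le_lt_trans leM)// ltry.
by split=> //; rewrite -lee_fin -nnsumE.
Qed.

Lemma nnsum_ub h (s : seq Y) : nnsummable h -> uniq s ->
  \sum_(y <- s) h y <= nnsum h.
Proof.
move=> nh us; rewrite -lee_fin -nnsumE//; apply: esum_ge.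
exists [set` s] => //.
rewrite -sumEFin (fsbig_seq _ _ us)//.
Qed.

Lemma nnsummable_le h h' : (forall y, 0 <= h y <= h' y) -> nnsummable h' ->
  nnsummable h /\ nnsum h <= nnsum h'.
Proof.
move=> hh' nh'; apply: nnsummableP => [y|s us]; first by case/andP: (hh' y).
by apply: le_trans (nnsum_ub nh' us); apply: ler_sum => y _; case/andP: (hh' y).
Qed.

Lemma nnsumD h h' : nnsummable h -> nnsummable h' ->
  nnsummable (fun y => h y + h' y) /\
  nnsum (fun y => h y + h' y) = nnsum h + nnsum h'.
Proof.
move=> nh nh'; have [[h0 hoo] [h'0 h'oo]] := (nh, nh').
have E : (\esum_(y in [set: Y]) (h y + h' y)%:E)%E = (nnsum h + nnsum h')%:E.
  rewrite EFinD -!nnsumE// -esumD//.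
  - by move=> y _; rewrite lee_fin.
  - by move=> y _; rewrite lee_fin.
by rewrite /nnsum /nnsummable E; split=> //; split=> [y|]; rewrite ?addr_ge0 ?ltry.
Qed.

Lemma nnsumZ a h : 0 <= a -> nnsummable h ->
  nnsummable (fun y => a * h y) /\ nnsum (fun y => a * h y) = a * nnsum h.
Proof.
have le_Z c k : 0 <= c -> nnsummable k ->
  nnsummable (fun y => c * k y) /\ nnsum (fun y => c * k y) <= c * nnsum k.
  move=> c0 nk; apply: nnsummableP => [y|s us]; first by rewrite mulr_ge0// nk.1.
  by rewrite -mulr_sumr ler_wpM2l// nnsum_ub.
move=> a0 nh; have [nah le1] := le_Z _ _ a0 nh; split=> //.
apply/eqP; rewrite eq_le le1 /=.
have [a_eq0|a_neq0] := eqVneq a 0.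
  by rewrite a_eq0 mul0r; apply: nnsum_ge0 => y; rewrite mul0r.
(* The inequality already proved, applied to [a^-1] and [a * h], gives the reverse one. *)
have [_] := le_Z a^-1 _ ltac:(by rewrite invr_ge0) nah.
rewrite (_ : (fun y => _) = h); last by apply/funext => y; rewrite mulKf.
by rewrite -ler_pdivrMl ?invr_gt0 ?lt_def ?a_neq0// invrK.
Qed.

Lemma nnsum0 h : nnsummable h -> nnsum h = 0 -> forall y, h y = 0.
Proof.
move=> nh sh y; apply/eqP; rewrite eq_le nh.1 andbT -sh.
by have := @nnsum_ub h [:: y] nh isT; rewrite big_seq1.
Qed.

Lemma nnsummable_finite h :
  (forall y, 0 <= h y) -> finite_set [set y | h y != 0] -> nnsummable h.
Proof.
move=> h0 fin; split=> //; set X := [set y | h y != 0] in fin.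
have -> : (\esum_(y in [set: Y]) (h y)%:E = \esum_(y in X) (h y)%:E)%E.
  rewrite [RHS]esum_mkcond; apply: eq_esum => y _.
  by case: ifPn => //; rewrite notin_setE /X /= => /negP; rewrite negbK => /eqP ->.
rewrite esum_fset//; last by move=> y _; rewrite lee_fin.
by rewrite fsbig_finite//= sumEFin ltry.
Qed.

Lemma nnsummable_reindex h (e : Y -> Y) :
  bijective e -> nnsummable h ->
  nnsummable (h \o e) /\ nnsum (h \o e) = nnsum h.
Proof.
move=> be [h0 hoo].
have E : (\esum_(y in [set: Y]) (h y)%:E = \esum_(y in [set: Y]) ((h \o e) y)%:E)%E.
  apply: (reindex_esum setT setT e (fun y => (h y)%:E)).
  by rewrite setTT_bijective.
by rewrite /nnsummable /nnsum -E; split=> //; split=> // y; exact: h0.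
Qed.

End NonnegSummable.

(** * The Hilbert space of square-summable functions *)

Section L2.
Local Open Scope ring_scope.
Variables (R : realType) (Y : choiceType).
Implicit Types f g : Y -> R.

Definition sq_summable : pred (Y -> R) :=
  fun f => `[< nnsummable (fun y => f y ^+ 2) >].

Definition l2 := {f : Y -> R | sq_summable f}.

HB.instance Definition _ := SubChoice.on l2.

Lemma sq_summableZ a f : sq_summable f -> sq_summable (a *: f).
Proof.
move=> /asboolP nf; apply/asboolP.
have [] := nnsumZ (sqr_ge0 a) nf.
by under eq_fun do rewrite -exprMn.
Qed.

Lemma sq_summableD f g : sq_summable f -> sq_summable g -> sq_summable (f + g).
Proof.
move=> /asboolP nf /asboolP ng; apply/asboolP.
have [+ _] := nnsumD (nnsumZ (ler0n R 2) nf).1 (nnsumZ (ler0n R 2) ng).1.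
move=> /nnsummable_le; move=> /(_ (fun y => (f + g) y ^+ 2)) [] // y.
rewrite sqr_ge0 -subr_ge0 -[(f + g) y]/(f y + g y) /=.
have -> : 2 * f y ^+ 2 + 2 * g y ^+ 2 - (f y + g y) ^+ 2 = (f y - g y) ^+ 2.
  by ring.
exact: sqr_ge0.
Qed.

Fact l2_submod : subsemimod_closed sq_summable.
Proof.
split; last by move=> a f; exact: sq_summableZ.
split; last exact: sq_summableD.
apply/asboolP; have [] // := @nnsummableP R Y (fun y => (0 : Y -> R) y ^+ 2) _ 0.
- by move=> y; exact: sqr_ge0.
- by move=> s _; rewrite big1// => y _; rewrite -[(0 : Y -> R) y]/(0 : R) expr0n.
Qed.

HB.instance Definition _ := GRing.SubChoice_isSubLmodule.Build R (Y -> R) sq_summable l2 l2_submod.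

Implicit Types u v w : l2.

Lemma l2D u v y : val (u + v) y = val u y + val v y. Proof. by []. Qed.
Lemma l2N u y : val (- u) y = - val u y. Proof. by []. Qed.
Lemma l2Z a u y : val (a *: u) y = a * val u y. Proof. by []. Qed.

Lemma l2P u : nnsummable (fun y => val u y ^+ 2).
Proof. by apply/asboolP; case: u. Qed.

Definition l2_sq u : R := nnsum (fun y => val u y ^+ 2).

Lemma l2_sq_ge0 u : 0 <= l2_sq u.
Proof. by apply: nnsum_ge0 => y; exact: sqr_ge0. Qed.

Lemma l2_sqZ a u : l2_sq (a *: u) = a ^+ 2 * l2_sq u.
Proof.
rewrite -(nnsumZ (sqr_ge0 a) (l2P u)).2.
by congr nnsum; apply/funext => y; rewrite l2Z exprMn.
Qed.

Lemma l2_sqN u : l2_sq (- u) = l2_sq u.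
Proof. by rewrite -scaleN1r l2_sqZ sqrrN expr1n mul1r. Qed.

Lemma l2_sq0 u : l2_sq u = 0 -> u = 0.
Proof.
move=> u0; apply/val_inj/funext => y.
by apply/eqP; rewrite -[_ == _]sqrf_eq0 (nnsum0 (l2P u) u0).
Qed.

(* With the polarized form, linearity reduces to pointwise identities between sums
   of squares, so only sums of nonnegative families are ever manipulated. *)
Definition l2_dot u v : R := (l2_sq (u + v) - l2_sq (u - v)) / 4.

Lemma l2_dotC u v : l2_dot u v = l2_dot v u.
Proof.
by rewrite /l2_dot [u + v]addrC -[u - v]opprB l2_sqN.
Qed.

Lemma l2_dotDl u v w : l2_dot (u + v) w = l2_dot u w + l2_dot v w.
Proof.
suff E : l2_sq (u + v + w) + l2_sq (u - w) + l2_sq (v - w) =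
         l2_sq (u + v - w) + l2_sq (u + w) + l2_sq (v + w).
  rewrite /l2_dot -mulrDl; congr (_ / _); move: E; lra.
rewrite /l2_sq.
rewrite -(nnsumD (l2P _) (l2P _)).2 -(nnsumD (nnsumD (l2P _) (l2P _)).1 (l2P _)).2.
rewrite -(nnsumD (l2P _) (l2P _)).2 -(nnsumD (nnsumD (l2P _) (l2P _)).1 (l2P _)).2.
by congr nnsum; apply/funext => y; rewrite !(l2D, l2N); ring.
Qed.

Lemma l2_dotNl u v : l2_dot (- u) v = - l2_dot u v.
Proof.
apply/eqP; rewrite -addr_eq0 -l2_dotDl addNr /l2_dot add0r sub0r.
by rewrite l2_sqN subrr mul0r.
Qed.

Lemma l2_dotZl a u v : l2_dot (a *: u) v = a * l2_dot u v.
Proof.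
(* Nonnegative scalars come first, since [nnsumZ] handles only these; [l2_dotNl] then covers the
   negative ones. *)
have pos c x : 0 <= c -> l2_dot (c *: x) v = c * l2_dot x v.
  move=> c0; suff E : l2_sq (c *: x + v) + c * l2_sq (x - v) =
         l2_sq (c *: x - v) + c * l2_sq (x + v).
    rewrite /l2_dot mulrA; congr (_ / _); move: E; lra.
  rewrite /l2_sq -!(nnsumZ c0 (l2P _)).2.
  rewrite -!(nnsumD (l2P _) (nnsumZ c0 (l2P _)).1).2.
  by congr nnsum; apply/funext => y; rewrite !(l2D, l2N, l2Z); ring.
have [/pos//|a0] := leP 0 a.
rewrite -[a in LHS]opprK scaleNr l2_dotNl pos ?oppr_ge0 1?ltW//.
by rewrite mulNr opprK.
Qed.

Lemma l2_dotE u : l2_dot u u = l2_sq u.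
Proof.
rewrite /l2_dot subrr -(scale0r u) l2_sqZ expr0n mul0r subr0.
rewrite -{1 2}[u]scale1r -scalerDl l2_sqZ; move: (l2_sq u) => q; lra.
Qed.

Definition l2_norm u := Num.sqrt (l2_sq u).

Lemma l2_normE u : l2_norm u ^+ 2 = l2_sq u.
Proof. by rewrite sqr_sqrtr// l2_sq_ge0. Qed.

Lemma l2_sqD u v : l2_sq (u + v) = l2_sq u + 2 * l2_dot u v + l2_sq v.
Proof.
rewrite -!l2_dotE l2_dotDl [l2_dot u (_ + _)]l2_dotC [l2_dot v (_ + _)]l2_dotC.
by rewrite !l2_dotDl [l2_dot v u]l2_dotC; ring.
Qed.

Lemma l2_normZ a u : l2_norm (a *: u) = `|a| * l2_norm u.
Proof. by rewrite /l2_norm l2_sqZ sqrtrM ?sqr_ge0// sqrtr_sqr. Qed.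

Lemma l2_norm_eq0 u : l2_norm u = 0 -> u = 0.
Proof. by move=> u0; apply: l2_sq0; rewrite -l2_normE u0 expr0n. Qed.

(** Apart from the degenerate cases, the squared norm of [|v| u - |u| v] is nonnegative and equals
    [2 |u| |v| (|u| |v| - <u, v>)]. *)
Lemma l2_CS u v : l2_dot u v <= l2_norm u * l2_norm v.
Proof.
have [u0|u0] := eqVneq (l2_norm u) 0.
  by rewrite (l2_norm_eq0 u0) -(scale0r (0 : l2)) l2_dotZl l2_normZ normr0 !mul0r.
have [v0|v0] := eqVneq (l2_norm v) 0.
  by rewrite (l2_norm_eq0 v0) -(scale0r (0 : l2)) l2_dotC l2_dotZl l2_normZ normr0 !mul0r mulr0.
have up : 0 < l2_norm u by rewrite lt_def u0 sqrtr_ge0.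
have vp : 0 < l2_norm v by rewrite lt_def v0 sqrtr_ge0.
have := l2_sq_ge0 (l2_norm v *: u - l2_norm u *: v).
rewrite l2_sqD -scaleNr !l2_sqZ l2_dotZl l2_dotC l2_dotZl sqrrN -!l2_normE [l2_dot v u]l2_dotC.
have -> : l2_norm v ^+ 2 * l2_norm u ^+ 2 +
    2 * (l2_norm v * (- l2_norm u * l2_dot u v)) + l2_norm u ^+ 2 * l2_norm v ^+ 2 =
    2 * (l2_norm u * l2_norm v) * (l2_norm u * l2_norm v - l2_dot u v) by ring.
by rewrite pmulr_rge0 ?subr_ge0// !mulr_gt0.
Qed.

Lemma l2_normD u v : l2_norm (u + v) <= l2_norm u + l2_norm v.
Proof.
rewrite -ler_sqr ?nnegrE ?addr_ge0 ?sqrtr_ge0// sqrrD !l2_normE l2_sqD.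
by have := l2_CS u v; lra.
Qed.

HB.instance Definition _ := Lmodule_isNormed.Build R l2 l2_normD l2_normZ l2_norm_eq0.

Lemma l2_coord_le u y : `|val u y| <= `|u|.
Proof.
rewrite -ler_sqr ?nnegrE// real_normK ?num_real// -[`|u|]/(l2_norm u) l2_normE.
by have := @nnsum_ub _ _ _ [:: y] (l2P u) isT; rewrite big_seq1.
Qed.

(** The limit [phi] is taken coordinatewise. The Cauchy bound passes to the limit in each finite
    partial sum, hence holds for the full sum. *)
Lemma l2_complete (F : set_system l2) : ProperFilter F -> cauchy F -> cvg F.
Proof.
move=> FF /cauchy_ballP Fc.
have Fsmall e : 0 < e ->
    exists2 P : set l2, F P & forall u v, P u -> P v -> `|u - v| < e.
  move=> e0; have [[P Q] [FP FQ] PQ] := Fc e e0.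
  exists (P `&` Q); first exact: filterI.
  move=> u v [Pu _] [_ Qv]; exact: (PQ (u, v)).
have coord_cvg y : cvg ((fun u : l2 => val u y) @ F).
  apply: cauchy_cvg; apply/cauchy_ballP => e /Fsmall[P FP Pe].
  exists ((fun u : l2 => val u y) @` P, (fun u : l2 => val u y) @` P).
    have FP' : F [set u | ((fun u : l2 => val u y) @` P) (val u y)].
      by apply: filterS FP => u Pu; exists u.
    by split.
  move=> [_ _] /= [[u Pu <-] [v Pv <-]].
  exact: le_lt_trans (l2_coord_le (u - v) y) (Pe _ _ Pu Pv).
pose phi y := lim ((fun u : l2 => val u y) @ F).
have near_phi e : 0 < e -> exists2 P : set l2, F P & forall u, P u ->
    nnsummable (fun y => (val u y - phi y) ^+ 2) /\
    nnsum (fun y => (val u y - phi y) ^+ 2) <= e ^+ 2.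
  move=> e0; have [P FP Pe] := Fsmall e e0; exists P => // u Pu.
  apply: nnsummableP => [y|s us]; first exact: sqr_ge0.
  have cv : (fun v : l2 => \sum_(y <- s) (val u y - val v y) ^+ 2) @ F -->
            \sum_(y <- s) (val u y - phi y) ^+ 2.
    elim: s {us} => [|y s IHs].
      by under eq_fun do rewrite big_nil; rewrite big_nil; exact: cvg_cst.
    under eq_fun do rewrite big_cons; rewrite big_cons; apply: cvgD IHs.
    apply: (@cvgM _ _ _ _ (fun v : l2 => val u y - val v y)
      (fun v : l2 => val u y - val v y));
      (apply: cvgB; [exact: cvg_cst|exact: coord_cvg]).
  rewrite -(cvg_lim _ cv)//; apply: limr_le; first by apply/cvg_ex; eexists; exact: cv.
  apply: filterS FP => v Pv.
  apply: le_trans (nnsum_ub (l2P (u - v)) us) _.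
  rewrite -/(l2_sq (u - v)) -l2_normE lerXn2r ?nnegrE ?sqrtr_ge0 ?(ltW e0)//.
  exact: ltW (Pe _ _ Pu Pv).
have [P FP Pphi] := near_phi 1 ltr01.
have phi_sq : sq_summable phi.
  have [u Pu] := filter_ex FP.
  have uphi : sq_summable (val u - phi) by apply/asboolP; have [] := Pphi u Pu.
  (* [phi] differs from an element of [l2] by the square-summable function [val u - phi]. *)
  rewrite (_ : phi = val u + (-1) *: (val u - phi)); last first.
    by rewrite scaleN1r opprB addrC subrK.
  by apply: sq_summableD; [case: (u)|exact: sq_summableZ].
apply/cvg_ex; exists (Sub phi phi_sq : l2); apply/cvgrPdist_le => e e0.
have [Q FQ Qphi] := near_phi e e0; apply: filterS FQ => u /Qphi[_ Qu].
rewrite distrC -ler_sqr ?nnegrE ?(ltW e0)//.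
by rewrite -[`|_|]/(l2_norm _) l2_normE.
Qed.

HB.instance Definition _ := Uniform_isComplete.Build l2 l2_complete.
HB.instance Definition _ := Complete.copy l2 l2.


Fact l2_dot_zmod_l v : zmod_morphism (l2_dot^~ v).
Proof. by move=> u w; rewrite l2_dotDl l2_dotNl. Qed.
Fact l2_dot_zmod_r u : zmod_morphism (l2_dot u).
Proof. by move=> v w; rewrite ![l2_dot u _]l2_dotC l2_dotDl l2_dotNl. Qed.


Fact l2_dot_scalable_l v : scalable_for *%R (l2_dot^~ v).
Proof. by move=> a u; rewrite l2_dotZl. Qed.
Fact l2_dot_scalable_r u : scalable_for (idfun \; *%R) (l2_dot u).
Proof. by move=> a v; rewrite ![l2_dot u _]l2_dotC l2_dotZl. Qed.

HB.instance Definition _ := isBilinear.Build R l2 l2 R *%R (idfun \; *%R) l2_dot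
  l2_dot_zmod_l l2_dot_zmod_r l2_dot_scalable_l l2_dot_scalable_r.

Fact l2_dot_hermitian u v : l2_dot u v = (-1) ^+ false * idfun (l2_dot v u).
Proof. by rewrite expr0 mul1r l2_dotC. Qed.

HB.instance Definition _ := isHermitianSesquilinear.Build R l2 false idfun l2_dot
  l2_dot_hermitian.

Fact l2_dot_gt0 u : u != 0 -> 0 < l2_dot u u.
Proof.
move=> u0; rewrite l2_dotE lt_def l2_sq_ge0 andbT.
by apply: contra_neq u0; exact: l2_sq0.
Qed.

HB.instance Definition _ := isDotProduct.Build R l2 l2_dot l2_dot_gt0.

Fact l2_hilbert_normE u : `|u| ^+ 2 = l2_dot u u.
Proof. by rewrite l2_dotE -l2_normE. Qed.

Definition l2_hilbert : realHilbert R :=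
  @RealHilbert R l2 (l2_dot : {dot l2 for @idfun R}) l2_hilbert_normE.

End L2.

(** * Commensurated subsets *)

Section CommensuratedAction.
Local Open Scope ring_scope.
Variables (R : realType) (G : groupType) (Y : choiceType).
Variables (act : G -> Y -> Y) (A : pred Y).
Hypothesis act1 : forall y, act 1%g y = y.
Hypothesis actM : forall g h y, act (g * h)%g y = act g (act h y).
Hypothesis A_comm : forall g, finite_set [set y | A (act g y) != A y].

Lemma act_bij g : bijective (act g).
Proof.
exists (act g^-1%g) => y; first by rewrite -actM mulVg.
by rewrite -actM mulgV.
Qed.

Fact translate_sq_summable g (u : l2 R Y) : sq_summable (val u \o act g^-1%g).
Proof. by apply/asboolP; have [] := nnsummable_reindex (act_bij g^-1%g) (l2P u). Qed.

Fact indic_sq_summable g :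
  sq_summable (fun y => (A (act g^-1%g y))%:R - (A y)%:R : R).
Proof.
apply/asboolP/nnsummable_finite => [y|]; first exact: sqr_ge0.
apply: sub_finite_set (A_comm g^-1%g) => y /=.
by apply: contra => /eqP ->; rewrite subrr expr0n.
Qed.

Definition translate g u : l2 R Y := Sub (val u \o act g^-1%g) (translate_sq_summable g u).

(** This is [1_{gA} - 1_A], formally the coboundary of the indicator of [A]; its finite support puts
    it in [l2] even when the indicator is not square-summable. *)
Definition wall_cocycle g : l2 R Y := Sub _ (indic_sq_summable g).

Definition wall_action g (u : l2_hilbert R Y) : l2_hilbert R Y :=
  (translate g u + wall_cocycle g : l2 R Y).

Lemma wall_actionE g u y : val (wall_action g u : l2 R Y) y =
  val (u : l2 R Y) (act g^-1%g y) + ((A (act g^-1%g y))%:R - (A y)%:R).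
Proof. by []. Qed.

Lemma wall_action_isometric : affine_isometric_action wall_action.
Proof.
split=> [u|g h u|g].
- by apply/val_inj/funext => y; rewrite wall_actionE invg1 act1 subrr addr0.
- by apply/val_inj/funext => y; rewrite !wall_actionE invgM actM; ring.
split=> [t u v|u v].
  apply/val_inj/funext => y; rewrite wall_actionE.
  rewrite !l2D !l2Z !wall_actionE; ring.
apply/eqP; rewrite -(@eqrXn2 _ 2)// ?normr_ge0//; apply/eqP.
rewrite -![`|_|]/(l2_norm _) !l2_normE.
rewrite /l2_sq -[RHS](nnsummable_reindex (act_bij g^-1%g) (l2P _)).2.
congr nnsum; apply/funext => y.
change ((val (wall_action g u : l2 R Y) y - val (wall_action g v : l2 R Y) y) ^+ 2 =
  (val (u : l2 R Y) (act g^-1%g y) - val (v : l2 R Y) (act g^-1%g y)) ^+ 2).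
by rewrite !wall_actionE; ring.
Qed.

(** For [k] nonzero, enough points of [S] would contribute more than the whole sum of squares. *)
Lemma l2_cst_infinite (u : l2 R Y) (k : R) (S : set Y) : infinite_set S ->
  (forall y, S y -> val u y = k) -> k = 0.
Proof.
move=> infS uk; apply: contrapT => /eqP k0.
have k2 : 0 < k ^+ 2 by rewrite exprn_even_gt0.
have [n kn] : exists n : nat, nnsum (fun y => val u y ^+ 2) < k ^+ 2 * n%:R.
  exists (Num.truncn (nnsum (fun y => val u y ^+ 2) / k ^+ 2)).+1.
  by rewrite mulrC -ltr_pdivrMr// truncnS_gt.
have /infinite_set_fset := infS => /(_ n) [B BS nB].
have := nnsum_ub (l2P u) (finmap.fset_uniq B).
rewrite (eq_big_seq (fun=> k ^+ 2)); last first.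
  by move=> y yB; rewrite uk//; apply: BS.
rewrite big_const_seq count_predT iter_addr_0 -mulr_natr => /le_lt_trans /(_ kn).
by rewrite ltr_pM2l// ltr_nat ltnNge nB.
Qed.

(* A fixed point [u] makes [u + 1_A] a [G]-invariant function, which is constant
   on the orbit of [y0]; square-summability of [u] forces the constant to be both
   [1] and [0]. *)
Lemma commensurated_not_T (y0 : Y) :
  infinite_set [set y | A y /\ exists g, y = act g y0] ->
  infinite_set [set y | ~~ A y /\ exists g, y = act g y0] ->
  ~ has_property_T R G.
Proof.
move=> infA infNA /(_ _ _ wall_action_isometric)[u ufix].
have inv g : val (u : l2 R Y) (act g y0) + (A (act g y0))%:R = val (u : l2 R Y) y0 + (A y0)%:R.
  have := congr1 (fun v : l2 R Y => val v (act g y0)) (ufix g).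
  rewrite wall_actionE -actM mulVg act1 => <-; ring.
set c := _ + _ in inv.
have c0 : c = 0.
  apply: (l2_cst_infinite (u := u) infNA) => y [/negbTE Ay [g yE]].
  by rewrite -(inv g) -yE Ay addr0.
have c1 : c - 1 = 0.
  apply: (l2_cst_infinite (u := u) infA) => y [Ay [g yE]].
  by rewrite -(inv g) -yE Ay addrK.
by move/eqP: c1; rewrite c0 sub0r oppr_eq0 oner_eq0.
Qed.

End CommensuratedAction.

Local Open Scope group_scope.

Lemma morph1g (G H : groupType) (f : G -> H) : {morph f : x y / x * y} -> f 1 = 1.
Proof. by move=> fM; apply: (mulgI (f 1)); rewrite -fM !mulg1. Qed.

Lemma morphVg (G H : groupType) (f : G -> H) :
  {morph f : x y / x * y} -> {morph f : x / x^-1}.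
Proof. by move=> fM x; apply: (mulgI (f x)); rewrite -fM !mulgV (morph1g fM). Qed.

Lemma morphXg (G H : groupType) (f : G -> H) :
  {morph f : x y / x * y} -> forall x n, f (x ^+ n) = f x ^+ n.
Proof.
move=> fM x; elim=> [|n IHn]; first by rewrite !expg0 (morph1g fM).
by rewrite !expgS fM IHn.
Qed.

Lemma Aut_mulE (G : groupType) (f g : Aut G) x : val (f * g) x = val f (val g x).
Proof. by []. Qed.

(** * Induction from a subgroup of finite index in the automorphism group *)

Section InducedAction.
Variables (R : realType) (W D : groupType) (rho : W -> D).
Hypothesis rhoM : {morph rho : x y / x * y}.
Hypothesis rho_surj : forall d, exists w, rho w = d.
Variables (Y : choiceType) (act : D -> Y -> Y) (A : pred Y).
Hypothesis act1 : forall y, act 1 y = y.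
Hypothesis actM : forall g h y, act (g * h) y = act g (act h y).
Hypothesis A_comm : forall g, finite_set [set y | A (act g y) != A y].
Hypothesis act_center : forall z, (forall d, z * d = d * z) -> forall y, act z y = y.

Implicit Types (a b c g h : Aut W) (d : D).

Definition lifts_conj a d := forall x, rho (val a x) = d * rho x * d^-1.

(** These automorphisms descend along [rho] to inner automorphisms of [D]. They form the subgroup
    [B] from which the action on [Y] is induced. *)
Definition inner_mod a := exists d, lifts_conj a d.

Lemma lifts_conjM a b d e : lifts_conj a d -> lifts_conj b e -> lifts_conj (a * b) (d * e).
Proof. by move=> ad be x; rewrite Aut_mulE ad be invgM !mulgA. Qed.

Lemma lifts_conj1 : lifts_conj 1 1.
Proof. by move=> x; rewrite mul1g invg1 mulg1. Qed.

Lemma lifts_conjV a d : lifts_conj a d -> lifts_conj a^-1 d^-1.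
Proof.
move=> ad x; rewrite -{2}[x](Aut_invKV a x) ad -[Aut_inv a]/(a^-1).
by rewrite invgK !mulgA mulVg mul1g -mulgA mulVg mulg1.
Qed.

(** As [rho] is onto, [d] and [e] induce the same conjugation of [D], so they differ by a central
    element, which acts trivially. Hence the choice made in [conjugator] does not affect the
    action. *)
Lemma act_lifts_conj a d e y : lifts_conj a d -> lifts_conj a e -> act d y = act e y.
Proof.
move=> ad ae; rewrite -[e in RHS](mulVKg d) actM (act_center (z := d^-1 * e))// => f.
have [w <-] := rho_surj f; have := ad w; rewrite ae => /(congr1 (fun u => d^-1 * u * e)).
by rewrite !mulgA mulgVK => ->; rewrite mulVg mul1g -mulgA.
Qed.

Definition conjugator a : D := xget 1 [set d | lifts_conj a d].

Lemma conjugatorP a : inner_mod a -> lifts_conj a (conjugator a).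
Proof. by move=> [d ad]; rewrite /conjugator; case: xgetP => // /(_ d). Qed.

Lemma act_conjugator a d y : lifts_conj a d -> act (conjugator a) y = act d y.
Proof. by move=> ad; apply: act_lifts_conj (ad); apply: conjugatorP; exists d. Qed.

(** The choice is made from the coset [aB] as a set, so it depends on the coset alone. *)
Definition coset_rep a : Aut W := xget 1 [set b | inner_mod (a^-1 * b)].

Lemma coset_repP a : inner_mod (a^-1 * coset_rep a).
Proof.
rewrite /coset_rep; case: xgetP => // /(_ a) /= []; exists 1.
by rewrite mulVg; exact: lifts_conj1.
Qed.

Lemma coset_rep_eq a b : inner_mod (a^-1 * b) -> coset_rep a = coset_rep b.
Proof.
move=> [d abd]; rewrite /coset_rep; congr xget; apply/seteqP; split=> c [e ce].
  exists (d^-1 * e); have := lifts_conjM (lifts_conjV abd) ce.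
  by rewrite invgM invgK !mulgA mulgK.
exists (d * e); have := lifts_conjM abd ce; by rewrite !mulgA mulgK.
Qed.

Lemma coset_repK a : coset_rep (coset_rep a) = coset_rep a.
Proof. by rewrite -(coset_rep_eq (coset_repP a)). Qed.

Lemma coset_rep_mul g a : coset_rep (g * coset_rep a) = coset_rep (g * a).
Proof.
apply/esym/coset_rep_eq; have := coset_repP a.
by rewrite invgM !mulgA mulgVK.
Qed.

Lemma coset_rep_invP a : inner_mod ((coset_rep a)^-1 * a).
Proof.
have [d ad] := coset_repP a; exists d^-1; have := lifts_conjV ad.
by rewrite invgM invgK.
Qed.

(* The induced [G]-set, with [(c, y)] standing for the class of [(c, y)] in
   [Aut W x_B Y] when [c] is a chosen coset representative; the other pairs are
   fixed. *)
Definition ind_act g (p : Aut W * Y) : Aut W * Y :=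
  if coset_rep p.1 == p.1 then
    (coset_rep (g * p.1), act (conjugator ((coset_rep (g * p.1))^-1 * (g * p.1))) p.2)
  else p.

Definition ind_set : pred (Aut W * Y) := fun p => (coset_rep p.1 == p.1) && A p.2.

Lemma ind_act1 p : ind_act 1 p = p.
Proof.
case: p => c y; rewrite /ind_act /=; case: eqP => // cE; rewrite mul1g cE mulVg.
by rewrite (act_conjugator _ lifts_conj1) act1.
Qed.

Lemma ind_actM g h p : ind_act (g * h) p = ind_act g (ind_act h p).
Proof.
case: p => c y; rewrite /ind_act /=; case: eqP => [cE|cE] /=; last by rewrite ifF//; apply/eqP.
rewrite coset_repK eqxx coset_rep_mul -!mulgA -actM; congr (_, _).
apply: act_conjugator.
have := lifts_conjM (conjugatorP (coset_rep_invP (g * coset_rep (h * c))))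
 (conjugatorP (coset_rep_invP (h * c))).
by rewrite coset_rep_mul -!mulgA mulVKg.
Qed.

(** Over each of the finitely many representatives, [g] acts on [Y] through a single element of [D],
    so [A_comm] applies fibre by fibre. *)
Lemma ind_set_comm : finite_set (range coset_rep) ->
  forall g, finite_set [set p | ind_set (ind_act g p) != ind_set p].
Proof.
move=> fin g.
apply: (@sub_finite_set _ _ (\bigcup_(c in range coset_rep)
  [set (c, y) | y in [set y | A (act (conjugator ((coset_rep (g * c))^-1 * (g * c))) y) != A y]])).
  move=> [c y] /=; rewrite /ind_set /ind_act /=.
  case: (coset_rep c =P c) => [cE|cE] /=; last by move: cE => /eqP/negbTE ->.
  rewrite coset_repK eqxx /= => yA; exists c; first by exists c.
  by exists y.
by apply: bigcup_finite => // c _; apply: finite_image; exact: A_comm.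
Qed.

(** [coset_rep] factors through any [key] whose fibres lie in single cosets, so finitely many keys
    mean finite index. *)
Lemma finite_coset_rep (K : Type) (key : Aut W -> K) :
  finite_set (range key) ->
  (forall a b, key a = key b -> inner_mod (a^-1 * b)) ->
  finite_set (range coset_rep).
Proof.
move=> fin keyP.
have [|f fK] := @choice _ _ (fun (k : K) (c : Aut W) =>
  forall a, key a = k -> coset_rep a = c).
  move=> k; have [[a ak]|nk] := pselect (exists a, key a = k).
    by exists (coset_rep a) => b bk; apply/esym/coset_rep_eq/keyP; rewrite ak bk.
  by exists 1 => a ak; case: nk; exists a.
apply: sub_finite_set (finite_image f fin) => _ [a _ <-].
by exists (key a); [exists a|rewrite -(fK _ a erefl)].
Qed.

Lemma inner_mod_not_T (K : Type) (key : Aut W -> K) (y0 : Y) :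
  infinite_set [set y | A y /\ exists d, y = act d y0] ->
  infinite_set [set y | ~~ A y /\ exists d, y = act d y0] ->
  finite_set (range key) ->
  (forall a b, key a = key b -> inner_mod (a^-1 * b)) ->
  ~ has_property_T R (Aut W).
Proof.
move=> infA infNA fin keyP.
have fin_rep := finite_coset_rep fin keyP.
pose c0 := coset_rep 1.
(* Conjugation by a lift [w] of [d] lies in [B]; transported by [c0], it acts on the fibre over [c0]
   as [d]. *)
have reach d : exists g, ind_act g (c0, y0) = (c0, act d y0).
  have [w wd] := rho_surj d.
  have conj_aut : is_automorphism (fun x => w * x * w^-1).
    apply/asboolP; split=> [x y|]; first by rewrite !mulgA mulgVK.
    exists (fun x => w^-1 * x * w) => x; first by rewrite !mulgA mulVg mul1g mulgVK.
    by rewrite !mulgA mulgV mul1g mulgK.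
  pose b : Aut W := Sub _ conj_aut.
  have bd : lifts_conj b d.
    by move=> x; rewrite SubK !rhoM (morphVg rhoM) wd.
  exists (c0 * b * c0^-1); rewrite /ind_act /= coset_repK eqxx mulgVK.
  have -> : coset_rep (c0 * b) = c0.
    by rewrite -[RHS]coset_repK; apply/esym/coset_rep_eq; exists d; rewrite mulKg.
  by rewrite mulKg (act_conjugator _ bd).
apply: (commensurated_not_T ind_act1 ind_actM (ind_set_comm fin_rep) (y0 := (c0, y0))).
  apply: contra_not infA => /(finite_image snd); apply: sub_finite_set.
  move=> y [Ay [d yE]]; exists (c0, y) => //; split; first by rewrite /ind_set /= coset_repK eqxx.
  by have [g gE] := reach d; exists g; rewrite gE yE.
apply: contra_not infNA => /(finite_image snd); apply: sub_finite_set.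
move=> y [Ay [d yE]]; exists (c0, y) => //; split; first by rewrite /ind_set /= coset_repK eqxx.
by have [g gE] := reach d; exists g; rewrite gE yE.
Qed.

End InducedAction.

(** * The reflection cocycle of a Coxeter group *)

Section ReflectionCocycle.
Variable Gamma : coxeter_graph.
Local Notation V := (cox_vertex Gamma).
Local Notation W := (coxeter_group Gamma).
Implicit Types (v s : V) (w t x : W) (l : seq V) (u : word V).

Definition gen v : W := presented_gen (@cox_relators Gamma) v.

Definition cls u : W := class_of_word (@cox_relators Gamma) u.

Lemma cls_cat u u' : cls (u ++ u') = cls u * cls u'.
Proof. exact: class_of_wordM. Qed.

Lemma cls_nil : cls [::] = 1. Proof. by []. Qed.

Lemma cls_word_eq u u' : word_eq (@cox_relators Gamma) u u' -> cls u = cls u'.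
Proof. by move=> uu'; apply/class_of_wordP. Qed.

Lemma cls_relator u : cox_relators u -> cls u = 1.
Proof.
move=> ru; rewrite -cls_nil; apply: cls_word_eq.
by have := @word_eq_relator _ (@cox_relators Gamma) [::] [::] u ru; rewrite cats0.
Qed.

Lemma gen_sq v : gen v * gen v = 1.
Proof. by rewrite -[LHS]cls_cat; apply: cls_relator; left; exists v. Qed.

Lemma genV v : (gen v)^-1 = gen v.
Proof. by apply: (mulgI (gen v)); rewrite gen_sq mulgV. Qed.

Lemma genK v : involutive (fun w => gen v * w).
Proof. by move=> w; rewrite mulgA gen_sq mul1g. Qed.

Lemma genKr v : involutive (fun w => w * gen v).
Proof. by move=> w; rewrite -mulgA gen_sq mulg1. Qed.

Lemma gen_conj_eq v t : (gen v * t * gen v == gen v) = (t == gen v).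
Proof.
apply/eqP/eqP => [E|->]; last by rewrite gen_sq mul1g.
by rewrite -[t](genK v) -[_ * t](genKr v) E gen_sq mulg1.
Qed.

Lemma cls_letter v b : cls [:: (v, b)] = gen v.
Proof.
case: b => //; rewrite -[RHS]genV; apply: (mulgI (gen v)); rewrite mulgV.
rewrite -[LHS]cls_cat -cls_nil; apply: cls_word_eq.
exact: (@word_eq_cancel _ _ [::] [::] v true).
Qed.

Lemma cls_cons v b u : cls ((v, b) :: u) = gen v * cls u.
Proof. by rewrite -cat1s cls_cat cls_letter. Qed.

(* The parity of the number of times the path [u] crosses the wall of [t]. *)
Fixpoint word_cocycle u t : bool :=
  if u is (v, _) :: u' then (t == gen v) (+) word_cocycle u' (gen v * t * gen v)
  else false.

Lemma word_cocycle_cat u u' t :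
  word_cocycle (u ++ u') t = word_cocycle u t (+) word_cocycle u' ((cls u)^-1 * t * cls u).
Proof.
elim: u t => [|[v b] u IHu] t /=; first by rewrite cls_nil invg1 mul1g mulg1.
by rewrite IHu -addbA cls_cons invgM genV !mulgA.
Qed.

(* The reflections crossed by [(v w)^m] are [(v w)^j v] for [j < 2 m]; when
   [(v w)^m = 1] each one is crossed an even number of times. *)
Lemma word_cocycle_dihedral v v' m t (c := gen v * gen v') :
  word_cocycle (flatten (nseq m [:: (v, true); (v', true)])) t =
  \big[addb/false]_(0 <= j < m.*2) (t == c ^+ j * gen v).
Proof.
have cE : gen v * c^-1 = c * gen v by rewrite invgM !genV mulgA.
have c_eq z : (gen v * z * gen v == gen v') = (z == c * gen v).
  rewrite /c; apply/eqP/eqP => [<-|->].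
    by rewrite -!mulgA gen_sq mulg1 genK.
  by rewrite !mulgA gen_sq mul1g genKr.
have c_conj z : gen v' * (gen v * z * gen v) * gen v' = c^-1 * z * c.
  by rewrite /c invgM !genV !mulgA.
clearbody c; elim: m t => [|m IHm] t; first by rewrite big_geq.
rewrite /= doubleS !big_nat_recl// IHm expg0 mul1g; congr (_ (+) _).
rewrite expg1 c_eq; congr (_ (+) _); apply: eq_big_nat => j _.
rewrite c_conj; apply/eqP/eqP => [E|->].
  rewrite -[t](mulVKg c) -[_ * t](mulgK c) E.
  rewrite expgS expgSr; move: (c ^+ j) => d.
  by rewrite -!mulgA cE.
rewrite expgS expgSr; move: (c ^+ j) => d.
by rewrite -!mulgA mulKg !mulgA -(mulgA d) -cE !mulgA mulgVK.
Qed.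

Lemma word_cocycle_relator u t : cox_relators u -> word_cocycle u t = false.
Proof.
move=> ru; case: (ru) => [[v ->]|[v [v' [_ uE]]]].
  by rewrite /= addbF gen_conj_eq addbb.
set m := cox_label _ in uE.
have cm : (gen v * gen v') ^+ m = 1.
  rewrite -(cls_relator ru) uE; elim: (m) => [|k IHk]; first by rewrite expg0 cls_nil.
  by rewrite expgS IHk /= !cls_cons mulgA.
(* The range is cut at [m]: since [(v v')^m = 1], its second half repeats the first and the two
   parities cancel. *)
rewrite uE word_cocycle_dihedral (@big_cat_nat _ _ _ m)//=; last by rewrite -addnn leq_addr.
rewrite -{2}[m]add0n big_addn -addnn addnK.
rewrite [X in _ (+) X](_ : _ = \big[addb/false]_(0 <= j < m)
  (t == (gen v * gen v') ^+ j * gen v)); first exact: addbb.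
by apply: eq_big_nat => j _; rewrite expgnDr cm mulg1.
Qed.

Lemma word_cocycle_eq u u' t : word_eq (@cox_relators Gamma) u u' ->
  word_cocycle u t = word_cocycle u' t.
Proof.
move=> uu'; elim: uu' t => {u u'} [//|u u' _ IH t|u u' u'' _ IH1 _ IH2 t|u u' v b t|u u' r rr t].
- by rewrite IH.
- by rewrite IH1 IH2.
- rewrite !word_cocycle_cat /=; congr (_ (+) _); rewrite gen_conj_eq.
  by rewrite addbF addbb addFb !cls_cons cls_nil mulg1 gen_sq invg1 mul1g mulg1.
- rewrite !word_cocycle_cat /=; congr (_ (+) _).
  by rewrite word_cocycle_relator// cls_relator// invg1 mul1g mulg1.
Qed.

(** The [t] with value [true] form the inversion set of [w]: the reflections whose walls separate
    [1] from [w]. *)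
Definition cocycle w t : bool := word_cocycle (repr w) t.

Lemma cocycle_cls u t : cocycle (cls u) t = word_cocycle u t.
Proof. exact/word_cocycle_eq/repr_class_of_word. Qed.

Lemma cls_repr w : cls (repr w) = w.
Proof. exact: class_of_word_repr. Qed.

Lemma cocycleM w w' t : cocycle (w * w') t = cocycle w t (+) cocycle w' (w^-1 * t * w).
Proof.
rewrite -[w in LHS]cls_repr -[w' in LHS]cls_repr -cls_cat cocycle_cls.
by rewrite word_cocycle_cat cls_repr.
Qed.

Lemma cocycle1 t : cocycle 1 t = false.
Proof. by rewrite -cls_nil cocycle_cls. Qed.

Lemma cocycle_gen v t : cocycle (gen v) t = (t == gen v).
Proof. by rewrite -(cls_letter v true) cocycle_cls /= addbF cls_letter. Qed.

Lemma cocycleV w t : cocycle w^-1 t = cocycle w (w * t * w^-1).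
Proof.
have := cocycleM w w^-1 (w * t * w^-1); rewrite mulgV cocycle1.
by rewrite !mulgA mulVg mul1g mulgVK; case: cocycle; case: cocycle.
Qed.

Lemma cocycle_genM v w t :
  cocycle (gen v * w) t = (t == gen v) (+) cocycle w (gen v * t * gen v).
Proof. by rewrite cocycleM cocycle_gen genV. Qed.

(** * Word length and the exchange condition *)

Definition prg l : W := \prod_(v <- l) gen v.

Lemma prg_cons v l : prg (v :: l) = gen v * prg l. Proof. exact: big_cons. Qed.
Lemma prg_cat l l' : prg (l ++ l') = prg l * prg l'. Proof. exact: big_cat. Qed.
Lemma prg_nil : prg [::] = 1. Proof. exact: big_nil. Qed.

Lemma prg_ex w : exists l, prg l = w.
Proof.
exists (unzip1 (repr w)); rewrite -[RHS]cls_repr; elim: (repr w) => [|[v b] u IHu].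
  exact: prg_nil.
by rewrite cls_cons -IHu -prg_cons.
Qed.

Fact len_subproof w : exists n, `[< exists l, prg l = w /\ size l = n >].
Proof. by have [l lw] := prg_ex w; exists (size l); apply/asboolP; exists l. Qed.

Definition len w := ex_minn (len_subproof w).

Local Arguments len w%_group_scope.

Lemma len_ex w : exists l, prg l = w /\ size l = len w.
Proof. by rewrite /len; case: ex_minnP => n /asboolP. Qed.

Lemma len_prg l : (len (prg l) <= size l)%N.
Proof. by rewrite /len; case: ex_minnP => n _; apply; apply/asboolP; exists l. Qed.

Lemma lenV w : len w^-1 = len w.
Proof.
suff le x : (len x^-1 <= len x)%N by apply/eqP; rewrite eqn_leq le -{1}[w]invgK le.
have [l [<- <-]] := len_ex x.
suff -> : (prg l)^-1 = prg (rev l) by rewrite -(size_rev l) len_prg.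
elim: l => [|v l IHl]; first by rewrite prg_nil invg1.
by rewrite prg_cons invgM genV IHl rev_cons -cats1 prg_cat prg_cons prg_nil mulg1.
Qed.

(** Strong exchange: left multiplication by [t] deletes the first letter at which the path crosses
    the wall of [t]. *)
Lemma prg_exchange l t : cocycle (prg l) t ->
  exists l', prg l' = t * prg l /\ (size l').+1 = size l.
Proof.
elim: l t => [|v l IHl] t; first by rewrite prg_nil cocycle1.
rewrite prg_cons cocycle_genM; have [->|_] := eqVneq t (gen v).
  by move=> _; exists l; rewrite genK.
move=> /IHl[l' [l'E sl']]; exists (v :: l'); rewrite prg_cons l'E /= sl'.
by rewrite -!mulgA genK.
Qed.

Lemma len_exchange w t : cocycle w t -> (len (t * w) < len w)%N.
Proof.
have [l [<- <-]] := len_ex w => /prg_exchange[l' [<- <-]]; rewrite ltnS.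
exact: len_prg.
Qed.

(** Multiplying by [gen v] toggles the cocycle at [gen v], so the exchange applies to
    [gen v * w]. *)
Lemma cocycleF_len w v : ~~ cocycle w (gen v) -> (len w < len (gen v * w))%N.
Proof.
move=> wv; have := @len_exchange (gen v * w) (gen v).
by rewrite genK; apply; rewrite cocycle_genM eqxx genKr (negbTE wv).
Qed.

Lemma cocycle_gen_len w v : cocycle w (gen v) = (len (gen v * w) < len w)%N.
Proof.
apply/idP/idP => [/len_exchange//|]; apply: contraTT => /cocycleF_len.
by rewrite -leqNgt => /ltnW.
Qed.

(** The first letter of a nonempty reduced word is a descent, hence a crossed wall. *)
Lemma cocycle_eq1 w : (forall t, ~~ cocycle w t) -> w = 1.
Proof.
move=> wF; have [[|v l] [lE sl]] := len_ex w; first by rewrite -lE prg_nil.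
have := wF (gen v); rewrite cocycle_gen_len -{1}lE prg_cons genK -sl /=.
by rewrite ltnS len_prg.
Qed.

Lemma cocycle_inj w w' : (forall t, cocycle w t = cocycle w' t) -> w = w'.
Proof.
move=> ww'; apply: (mulgI w^-1); rewrite mulVg; apply/esym/cocycle_eq1 => t.
by rewrite cocycleM cocycleV invgK -ww' addbb.
Qed.

(** * Involutions of minimal length in their conjugacy class *)

Definition conj_minimal w := forall x, (len w <= len (x * w * x^-1))%N.

Section MinimalInvolution.
Variable w : W.
Hypotheses (w2 : w * w = 1) (w_min : conj_minimal w).

(** Otherwise [gen v * w * gen v] is shorter than [w * gen v]. The latter is the inverse of
    [gen v * w], which is shorter than [w], against minimality. *)
Lemma minimal_descent_comm v : cocycle w (gen v) -> gen v * w = w * gen v.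
Proof.
move=> wv; have wV : w^-1 = w by apply: (mulgI w); rewrite w2 mulgV.
set u := gen v * w.
have ltu : (len u < len w)%N by exact: len_exchange.
have uV : len (w * gen v) = len u by rewrite -lenV invgM genV wV.
have uF : cocycle u (gen v) = false by rewrite cocycle_genM eqxx genKr wv.
have [E|NE] := eqVneq (u^-1 * gen v * u) (gen v).
  have : gen v * u = u * gen v by rewrite -{2}E !mulgA mulgV mul1g.
  by rewrite /u genK => {2}->; rewrite genKr.
have /cocycleF_len : ~~ cocycle (u * gen v) (gen v).
  by rewrite cocycleM uF cocycle_gen (negbTE NE).
rewrite mulgA /u genK uV => lt1.
have := w_min (gen v); rewrite genV -/u leqNgt.
by rewrite (ltn_trans lt1 ltu).
Qed.

(** Compare the cocycles of the two sides of [gen v * w = w * gen v]; the contributions of [gen v]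
    cancel. *)
Lemma minimal_descent_conj v t : cocycle w (gen v) ->
  cocycle w (gen v * t * gen v) = cocycle w t.
Proof.
move=> wv; have vw := minimal_descent_comm wv.
have := congr1 (cocycle^~ t) vw; rewrite cocycle_genM cocycleM cocycle_gen.
have -> : (w^-1 * t * w == gen v) = (t == gen v).
  apply/eqP/eqP => [E|->]; last by rewrite -mulgA vw mulKg.
  by rewrite -[t](mulVKg w) -[_ * t](mulgK w) E mulgA -vw mulgK.
by rewrite [RHS]addbC => /addbI.
Qed.

(* [w] commutes with each prefix whose letters are descents of [w], so rotating the
   prefix to the end gives another reduced word of [w], whose first letter is again
   a descent. *)
Lemma minimal_letters l : prg l = w -> size l = len w ->
  all (fun v => cocycle w (gen v)) l.
Proof.
move=> lw sl; suff H l1 l2 : l = l1 ++ l2 -> all (fun v => cocycle w (gen v)) l1.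
  by apply: (H l [::]); rewrite cats0.
elim/last_ind: l1 l2 => [//|l1 v IH] l2; rewrite cat_rcons => lE.
have l1w := IH _ lE; rewrite all_rcons l1w andbT.
have comm : prg l1 * w = w * prg l1.
  elim: (l1) l1w => [|s k IHk] /=; first by rewrite prg_nil mulg1 mul1g.
  by case/andP=> /minimal_descent_comm sw /IHk kw; rewrite prg_cons mulgA -sw -!mulgA kw.
have wE : w = prg (v :: l2 ++ l1).
  apply: (mulgI (prg l1)); rewrite comm -{1}lw lE !(prg_cat, prg_cons) !mulgA.
  by [].
rewrite cocycle_gen_len {1}wE prg_cons genK -sl lE (leq_ltn_trans (len_prg _))//.
by rewrite !size_cat /= addnS addnC.
Qed.

End MinimalInvolution.

(** A reduced word of [w] consists of descents of [w], which are also descents of [w']. Conjugation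
    by them preserves the cocycle of [w'], so every wall crossed by [w] is crossed by [w']; the
    converse is symmetric. *)
Lemma minimal_involution_inj w w' : w * w = 1 -> w' * w' = 1 ->
  conj_minimal w -> conj_minimal w' ->
  (forall v, cocycle w (gen v) = cocycle w' (gen v)) -> w = w'.
Proof.
have sub x x' : x * x = 1 -> x' * x' = 1 -> conj_minimal x -> conj_minimal x' ->
    (forall v, cocycle x (gen v) = cocycle x' (gen v)) ->
    forall t, cocycle x t -> cocycle x' t.
  move=> x2 x'2 xm x'm xx'; have [l [lx sl]] := len_ex x.
  have := minimal_letters x2 xm lx sl; rewrite -{2}lx.
  elim: l {lx sl} => [|v l IHl] /=; first by move=> _ t; rewrite prg_nil cocycle1.
  case/andP=> xv /IHl H t; rewrite prg_cons cocycle_genM.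
  have [->|_ /H] := eqVneq; first by rewrite -xx'.
  by rewrite minimal_descent_conj// -xx'.
move=> w2 w'2 wm w'm ww'; apply: cocycle_inj => t; apply/idP/idP; apply: sub => //.
Qed.

Lemma conj_minimal_ex w : exists x, conj_minimal (x * w * x^-1).
Proof.
have ex : exists n, `[< exists x, len (x * w * x^-1) = n >].
  by exists (len (1 * w * 1^-1)); apply/asboolP; exists 1.
case: (ex_minnP ex) => n /asboolP[x xn] nmin; exists x => y; rewrite xn; apply: nmin.
by apply/asboolP; exists (y * x); rewrite invgM !mulgA.
Qed.

Definition minimal_conjugator w := projT1 (cid (conj_minimal_ex w)).

(** The descent set of a shortest conjugate. There are finitely many subsets of [V], hence finitely
    many classes of involutions. *)
Definition involution_type w : {set V} :=
  [set v | cocycle (minimal_conjugator w * w * (minimal_conjugator w)^-1) (gen v)]%SET.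

Lemma involution_type_conj w w' : w * w = 1 -> w' * w' = 1 ->
  involution_type w = involution_type w' -> exists x, w' = x * w * x^-1.
Proof.
rewrite /involution_type /minimal_conjugator.
case: cid => x xm; case: cid => y ym /= w2 w'2 tE.
have sq (z t : W) : t * t = 1 -> z * t * z^-1 * (z * t * z^-1) = 1.
  by move=> t2; rewrite !mulgA mulgVK -(mulgA z) t2 mulg1 mulgV.
have E : x * w * x^-1 = y * w' * y^-1.
  apply: minimal_involution_inj => //; try exact: sq.
  by move=> v; have := congr1 (fun S : {set V} => v \in S) tE; rewrite !inE.
exists (y^-1 * x); rewrite invgM invgK !mulgA.
by rewrite -[w' in LHS](mulKg y) -[y * w'](mulgVK y) -E !mulgA.
Qed.

Lemma Aut_gen_sq (a : Aut W) v : val a (gen v) * val a (gen v) = 1.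
Proof. by rewrite -AutM gen_sq (morph1g (AutM a)). Qed.

Definition aut_type (a : Aut W) : {ffun V -> {set V}} :=
  [ffun v => involution_type (val a (gen v))].

Definition gen_conjugating (a : Aut W) :=
  forall v, exists x, val a (gen v) = x * gen v * x^-1.

(** As [aut_type] takes finitely many values, the generator-conjugating automorphisms have finitely
    many cosets. *)
Lemma aut_type_conjugating (a b : Aut W) : aut_type a = aut_type b ->
  gen_conjugating (a^-1 * b).
Proof.
move=> ab v; have /ffunP/(_ v) := ab; rewrite !ffunE.
move=> /(involution_type_conj (Aut_gen_sq _ _) (Aut_gen_sq _ _))[x bE].
exists (val a^-1 x); rewrite Aut_mulE bE !AutM (morphVg (AutM _)).
by rewrite (Aut_invK a).
Qed.

End ReflectionCocycle.

(** * Walls of a parabolic subgroup *)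

Lemma finite_cocycle (Gamma : coxeter_graph) (w : coxeter_group Gamma) :
  finite_set [set t | cocycle w t].
Proof.
have [l <-] := prg_ex w; elim: l => [|v l IHl].
  by apply: sub_finite_set (finite_set0 _) => t /=; rewrite prg_nil cocycle1.
apply: (@sub_finite_set _ _ ([set gen v] `|`
    (fun t => gen v * t * gen v) @` [set t | cocycle (prg l) t])).
  move=> t /=; rewrite prg_cons cocycle_genM; have [->|_ tl] := eqVneq; [by left|right].
  by exists (gen v * t * gen v) => //; rewrite !mulgA gen_sq mul1g genKr.
by rewrite finite_setU; split; [exact: finite_set1|exact: finite_image].
Qed.

Section ParabolicWalls.
Variables (Gamma : coxeter_graph) (D : groupType) (i : D -> coxeter_group Gamma).
Local Notation V := (cox_vertex Gamma).
Local Notation W := (coxeter_group Gamma).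
Hypothesis iM : {morph i : x y / x * y}.
Hypothesis i_inj : injective i.
Variable Omega : {set V}.
Hypothesis i_gen : forall v, v \in Omega -> exists d, i d = gen v.
Hypothesis i_generated : forall d,
  smallest (@is_subgroup W) [set gen v | v in [set` Omega]] (i d).
Implicit Types (d : D) (t : W) (s v : V).

Let i1 : i 1 = 1 := morph1g iM.
Let iV : {morph i : x / x^-1} := morphVg iM.

(** [D] is either [W] itself or a special parabolic embedded by [i]; only conjugation by [D] is
    allowed. *)
Definition reflection_class s : set W := [set t | exists d, t = i d * gen s * (i d)^-1].

Lemma reflection_classJ s d t : reflection_class s t -> reflection_class s (i d * t * (i d)^-1).
Proof. by move=> [e ->]; exists (d * e); rewrite iM invgM !mulgA. Qed.

Lemma reflection_class_gen s : reflection_class s (gen s).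
Proof. by exists 1; rewrite i1 invg1 mulg1 mul1g. Qed.

Lemma cocycle_reflection_class d t : cocycle (i d) t ->
  exists2 s, s \in Omega & reflection_class s t.
Proof.
pose S : set W := [set x | (exists d, i d = x) /\
  forall t, cocycle x t -> exists2 s, s \in Omega & reflection_class s t].
have SG : is_subgroup S.
  split=> [|_ _ [[e <-] eS] [[f <-] fS]|_ [[e <-] eS]].
  - by split=> [|t']; [exists 1|rewrite cocycle1].
  - split=> [|t']; first by exists (e * f).
    rewrite cocycleM; have [/eS //|_ /fS [s sO sC]] := boolP (cocycle (i e) t').
    by exists s => //; have := reflection_classJ e sC; rewrite !mulgA mulgV mul1g mulgK.
  - split=> [|t']; first by exists e^-1.
    rewrite cocycleV => /eS[s sO sC]; exists s => //.
    by have := reflection_classJ e^-1 sC; rewrite iV invgK !mulgA mulVg mul1g mulgVK.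
have /(_ S) [] := i_generated d; last by move=> _; apply.
split=> // _ [v vO <-]; split; first exact: i_gen.
by move=> t'; rewrite cocycle_gen => /eqP ->; exists v => //; exact: reflection_class_gen.
Qed.

(** An element of [D] is determined by the walls it crosses, all in these classes. If the classes
    were finite, [D] would embed into a finite set of Boolean vectors. *)
Lemma infinite_reflection_class : infinite_set [set: D] ->
  exists2 s, s \in Omega & infinite_set (reflection_class s).
Proof.
move=> infD; apply: contrapT => /forall2NP fin; apply: infD.
have finU : finite_set (\bigcup_(s in [set` Omega]) reflection_class s).
  apply: bigcup_finite => [|s sO]; first exact: finite_finset.
  by case: (fin s) => // /contrapT.
have [r rE] := (finite_seqP _).1 finU.
have -> : [set: D] = (fun d => map_tuple (cocycle (i d)) (in_tuple r)) @^-1` setT.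
  by rewrite preimage_setT.
apply: finite_preimage; last exact: finite_finset.
move=> d e _ _ /(congr1 val) /= /eq_in_map E; apply/i_inj/cocycle_inj => t.
have [/E//|tr] := boolP (t \in r).
have notr f : cocycle (i f) t = false.
  apply: contraNF tr => /cocycle_reflection_class[s sO st].
  have : [set` r] t by rewrite -rE; exists s.
  by [].
by rewrite !notr.
Qed.

Variable s : V.
Hypothesis sO : s \in Omega.
Hypothesis s_inf : infinite_set (reflection_class s).

(** A pair [(t, b)] is a wall with one of its sides; the cocycle tells whether [d] exchanges the
    labels of the sides. Pairs outside the class are fixed, to make the action total. *)
Definition wall_act d (p : W * bool) : W * bool :=
  if `[< reflection_class s p.1 >] then
    (i d * p.1 * (i d)^-1, p.2 (+) cocycle (i d) (i d * p.1 * (i d)^-1))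
  else p.

Definition wall_set : pred (W * bool) := fun p => `[< reflection_class s p.1 >] && p.2.

Lemma wall_act1 p : wall_act 1 p = p.
Proof.
case: p => t e; rewrite /wall_act /= i1; case: ifP => // _.
by rewrite invg1 mulg1 mul1g cocycle1 addbF.
Qed.

Lemma wall_actM d e p : wall_act (d * e) p = wall_act d (wall_act e p).
Proof.
case: p => t b; rewrite /wall_act /=; case: asboolP => [tC|tC] /=; last by rewrite asboolF.
rewrite asboolT; last exact: reflection_classJ.
rewrite iM invgM cocycleM !mulgA; congr (_, _).
by rewrite mulVg mul1g mulgVK -addbA; congr (_ (+) _); rewrite addbC.
Qed.

(** Within the class, membership changes exactly at the finitely many walls crossed by [i d^-1]. *)
Lemma wall_set_comm d : finite_set [set p | wall_set (wall_act d p) != wall_set p].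
Proof.
have fin := finite_cocycle (i d^-1).
apply: (@sub_finite_set _ _ ((pair^~ true) @` [set t | cocycle (i d^-1) t] `|`
  (pair^~ false) @` [set t | cocycle (i d^-1) t])); last first.
  by rewrite finite_setU; split; exact: finite_image.
move=> [t b] /=; rewrite /wall_set /wall_act /=.
have [tC|tC] := pselect (reflection_class s t); last by rewrite (asboolF tC) /= (asboolF tC).
rewrite (asboolT tC) /= (asboolT (reflection_classJ d tC)) /= -cocycleV -iV.
case: b => /=; case: (boolP (cocycle (i d^-1) t)) => // td _; [left|right]; by exists t.
Qed.

(** Centrality makes [i z] commute with the whole class and makes its cocycle constant there. The
    class is infinite and only finitely many walls are crossed, so the constant is [false]. *)
Lemma wall_act_center z : (forall d, z * d = d * z) -> forall p, wall_act z p = p.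
Proof.
move=> zC [t b]; rewrite /wall_act /=; case: asboolP => // tC.
have comm x : reflection_class s x -> i z * x * (i z)^-1 = x.
  move=> [d ->]; have [e <-] := i_gen sO.
  by rewrite -!iV -!iM zC mulgK.
have inv d x : reflection_class s x -> cocycle (i z) (i d * x * (i d)^-1) = cocycle (i z) x.
  move=> xC; have xC' := reflection_classJ d xC.
  have := congr1 (fun w => cocycle (i w) (i d * x * (i d)^-1)) (zC d).
  rewrite !iM !cocycleM.
  have -> : (i z)^-1 * (i d * x * (i d)^-1) * i z = i d * x * (i d)^-1.
    by rewrite -{1}(comm _ xC') !mulgA mulVg mul1g mulgVK.
  have -> : (i d)^-1 * (i d * x * (i d)^-1) * i d = x.
    by rewrite !mulgA mulVg mul1g mulgVK.
  by rewrite addbC => /addbI.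
have -> : cocycle (i z) (i z * t * (i z)^-1) = false; last by rewrite comm// addbF.
rewrite comm//; apply: contra_notF s_inf => zt; apply: sub_finite_set (finite_cocycle (i z)).
move=> _ [d ->] /=; rewrite inv; last exact: reflection_class_gen.
by case: tC zt => e ->; rewrite inv//; exact: reflection_class_gen.
Qed.

(** The element of [D] mapping to [gen s] fixes the wall of [s] and swaps its sides, so both sides
    of each wall are reached. *)
Lemma wall_orbit t b : reflection_class s t -> exists d, (t, b) = wall_act d (gen s, true).
Proof.
move=> [d tE]; have [e es] := i_gen sO.
have sC : `[< reflection_class s (gen s) >] by apply/asboolP/reflection_class_gen.
have E f : wall_act f (gen s, true) =
    (i f * gen s * (i f)^-1, ~~ cocycle (i f) (i f * gen s * (i f)^-1)).
  by rewrite /wall_act /= sC.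
have [bE|bE] := eqVneq b (~~ cocycle (i d) t); first by exists d; rewrite E -tE bE.
exists (d * e); rewrite wall_actM.
have -> : wall_act e (gen s, true) = (gen s, false).
  by rewrite E es genV genKr cocycle_gen eqxx.
rewrite /wall_act /= sC -tE; congr (_, _).
by move: bE; case: b; case: cocycle.
Qed.

Lemma wall_orbit_infinite b :
  infinite_set [set p | p.2 = b /\ `[< reflection_class s p.1 >] /\
     exists d, p = wall_act d (gen s, true)].
Proof.
move=> fin; apply: s_inf; apply: sub_finite_set (finite_image fst fin) => t tC.
by exists (t, b) => //; split=> //; split; [exact/asboolP|exact: wall_orbit].
Qed.

Lemma parabolic_not_T (R : realType) (rho : W -> D) (K : Type) (key : Aut W -> K) :
  {morph rho : x y / x * y} -> (forall d, exists w, rho w = d) ->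
  finite_set (range key) ->
  (forall a b, key a = key b -> inner_mod rho (a^-1 * b)) ->
  ~ has_property_T R (Aut W).
Proof.
move=> rhoM rho_surj fin keyP.
apply: (inner_mod_not_T rhoM rho_surj wall_act1 wall_actM wall_set_comm
  wall_act_center (y0 := (gen s, true)) _ _ fin keyP).
  apply: sub_infinite_set (wall_orbit_infinite (b := true)) => -[t b] /= [-> [tC tO]].
  by split=> //; rewrite /wall_set tC.
apply: sub_infinite_set (wall_orbit_infinite (b := false)) => -[t b] /= [-> [tC tO]].
by split=> //; rewrite /wall_set tC.
Qed.

End ParabolicWalls.

(** * Infinite dihedral quotients *)

(* [(e, k)] is the isometry [x |-> (-1)^e x + k] of the integers. *)
Definition dihedral : Type := (bool * int)%type.
HB.instance Definition _ := Choice.on dihedral.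

Definition flip (e : bool) (k : int) : int := if e then (- k)%R else k.

Definition dih_mul (g h : dihedral) : dihedral := (g.1 (+) h.1, (g.2 + flip g.1 h.2)%R).
Definition dih_inv (g : dihedral) : dihedral := (g.1, (- flip g.1 g.2)%R).

Fact dih_mulA : associative dih_mul.
Proof. by move=> [[] k] [[] l] [[] m]; rewrite /dih_mul /=; congr (_, _); ring. Qed.
Fact dih_mul1 : left_id (false, 0%R) dih_mul.
Proof. by move=> [e k]; rewrite /dih_mul /= add0r. Qed.
Fact dih_mulr1 : right_id (false, 0%R) dih_mul.
Proof. by move=> [[] k]; rewrite /dih_mul /= ?oppr0 addr0. Qed.
Fact dih_mulV : left_inverse (false, 0%R) dih_inv dih_mul.
Proof. by move=> [[] k]; rewrite /dih_mul /dih_inv /=; congr (_, _); ring. Qed.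
Fact dih_mulrV : right_inverse (false, 0%R) dih_inv dih_mul.
Proof. by move=> [[] k]; rewrite /dih_mul /dih_inv /=; congr (_, _); ring. Qed.

HB.instance Definition _ := isGroup.Build dihedral dih_mulA dih_mul1 dih_mulr1 dih_mulV dih_mulrV.

Lemma dihM e k f l : ((e, k) : dihedral) * (f, l) = (e (+) f, (k + flip e l)%R) :> dihedral.
Proof. by []. Qed.
Lemma dihV e k : ((e, k) : dihedral)^-1 = (e, (- flip e k)%R) :> dihedral.
Proof. by []. Qed.
Lemma dih1 : (1 : dihedral) = (false, 0%R). Proof. by []. Qed.

Lemma dih_transX (k : int) n : ((false, k) : dihedral) ^+ n = (false, (k *+ n)%R) :> dihedral.
Proof. by elim: n => [|n IHn]; rewrite ?expg0 ?mulr0n// expgS IHn dihM /= mulrS. Qed.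

(** The condition says that [g^-1] sends [0] to an integer [<= 0]. Left multiplication by [(e, k)]
    moves this image by a distance [|k|], even when [(e, k)] is a reflection. *)
Definition half_line : pred dihedral := fun g => (0 <= flip g.1 g.2)%R.

Lemma half_line_comm (g : dihedral) :
  finite_set [set y : dihedral | half_line (g * y) != half_line y].
Proof.
case: g => e k; pose N := `|k|%N.
apply: (@sub_finite_set _ _ (range (fun p : bool * 'I_(N + N).+1 =>
    (p.1, (p.2%:Z - N%:Z)%R) : dihedral))); last first.
  exact/finite_image/finite_finset.
move=> [f l] /= H; have lN : (- N%:Z <= l <= N%:Z)%R.
  move: H; rewrite /half_line dihM /flip /N.
  by case: e; case: f => /=; lia.
have lt : (absz (l + N%:Z)%R < (N + N).+1)%N by lia.
exists (f, Ordinal lt) => //=; congr (_, _); lia.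
Qed.

Lemma dihedral_centerless (z : dihedral) : (forall d, z * d = d * z) -> z = 1.
Proof.
case: z => e k zC; have := zC (false, 1%R); have := zC (true, 0%R).
rewrite !dihM /= => -[]; case: e {zC} => /= _ E []; first lia.
by move: E => /=; rewrite dih1 => E _; congr (_, _); lia.
Qed.

Lemma infinite_seq_dihedral (S : set dihedral) (f : nat -> int) :
  injective f -> (forall n, S (false, f n)) -> infinite_set S.
Proof.
move=> f_inj Sf fin; apply: infinite_nat.
have -> : [set: nat] = (fun n => (false, f n) : dihedral) @^-1` S.
  by apply/seteqP; split=> // n _; exact: Sf.
by apply: finite_preimage fin => m n _ _ [] /f_inj.
Qed.

(* The colours [Some false] and [Some true] are sent to the reflections fixing [0] and
   [1/2], which generate; vertices coloured [None] are killed. *)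
Definition colour_gen (c : option bool) : dihedral :=
  if c is Some b then (true, Posz b) else 1.

Lemma colour_gen_sq c : colour_gen c * colour_gen c = 1.
Proof. by case: c => [[]|] //=; rewrite mulg1. Qed.

(** * Dihedral quotients from vertex colourings *)

Section DihedralQuotient.
Variables (Gamma : coxeter_graph) (c : cox_vertex Gamma -> option bool).
Local Notation V := (cox_vertex Gamma).
Local Notation W := (coxeter_group Gamma).
Hypothesis c_edge : forall x y, cox_adj x y ->
  c x = c y \/ (~~ odd (cox_label [set x; y]%SET) /\ (c x = None \/ c y = None)).
(** Each class of colour [Some b] is connected through its own edges, expressed by functions
    constant along these edges. *)
Hypothesis c_conn : forall f : V -> dihedral,
  (forall x y, cox_adj x y -> c x = c y -> f x = f y) ->
  forall x y, c x = c y -> c x <> None -> f x = f y.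
Variables v0 v1 : V.
Hypotheses (cv0 : c v0 = Some false) (cv1 : c v1 = Some true).

(** An edge relator becomes a power of [1] when the colours agree, and otherwise an even power of an
    element of square [1]. *)
Lemma dihedral_quotient : exists F : W -> dihedral,
  {morph F : x y / x * y} /\ forall v, F (gen v) = colour_gen (c v).
Proof.
apply: (@presented_lift _ _ dihedral (fun v => colour_gen (c v))) => r.
case=> [[v ->]|[x [y [xy ->]]]].
  by rewrite /word_eval !big_cons big_nil mulg1 colour_gen_sq.
have -> m : word_eval (fun v => colour_gen (c v)) (flatten (nseq m [:: (x, true); (y, true)])) =
    (colour_gen (c x) * colour_gen (c y)) ^+ m.
  elim: m => [|m IHm]; first by rewrite /word_eval big_nil.
  by rewrite expgS -IHm /word_eval /= !big_cons /= mulgA.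
have even_pow z m : ~~ odd m -> colour_gen z ^+ m = 1.
  move=> /even_halfK <-; elim: m./2 => [|n IHn]; first by rewrite expg0.
  by rewrite doubleS !expgS IHn mulg1 colour_gen_sq.
have [->|[ev [->|->]]] := c_edge xy; first by rewrite colour_gen_sq expg1n.
  by rewrite mul1g even_pow.
by rewrite mulg1 even_pow.
Qed.

Variable F : W -> dihedral.
Hypothesis FM : {morph F : x y / x * y}.
Hypothesis F_gen : forall v, F (gen v) = colour_gen (c v).

Let F1 : F 1 = 1 := morph1g FM.

Lemma dihedral_quotient_surj d : exists w, F w = d.
Proof.
have trans_nat n : F ((gen v1 * gen v0) ^+ n) = (false, Posz n).
  rewrite (morphXg FM).
  by rewrite FM !F_gen cv0 cv1 /= dihM /= dih_transX; congr (_, _); lia.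
have trans k : exists w, F w = (false, k).
  case: k => n; first by exists ((gen v1 * gen v0) ^+ n).
  exists ((gen v1 * gen v0) ^+ n.+1)^-1; rewrite (morphVg FM) trans_nat dihV /=.
  by congr (_, _); lia.
case: d => -[] k; last exact: trans.
have [w wk] := trans k; exists (w * gen v0).
by rewrite FM wk F_gen cv0 dihM /=; congr (_, _); lia.
Qed.

(** [F \o val a] sends all vertices of one colour to one reflection. The two reflections so obtained
    generate the dihedral group, so their fixed points are at distance [1/2], and an isometry
    carries [0] and [1/2] to them. *)
Lemma gen_conjugating_inner_mod (a : Aut W) : gen_conjugating a -> inner_mod F a.
Proof.
move=> a_conj; pose f v := F (val a (gen v)).
have FaM : {morph (F \o val a) : x y / x * y} by move=> x y /=; rewrite AutM FM.
have f_conj v : exists d, f v = d * colour_gen (c v) * d^-1.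
  have [x ax] := a_conj v; exists (F x).
  by rewrite /f ax !FM (morphVg FM) F_gen.
have f_refl v b : c v = Some b -> exists k : int, f v = (true, (k *+ 2 + Posz b)%R).
  move=> cb; have [[e k] ->] := f_conj v; rewrite cb /= dihV !dihM /=.
  exists (if e then k - Posz b else k)%R; congr (_, _); first by case: e.
  by case: e => /=; lia.
have f_none v : c v = None -> f v = 1.
  by move=> cN; have [d ->] := f_conj v; rewrite cN mulg1 mulgV.
(* Two distinct reflections of the integers have a product of infinite order. *)
have f_adj x y : cox_adj x y -> c x = c y -> f x = f y.
  move=> xy cxy; case cx : (c x) => [b|]; last by rewrite !f_none// -cxy.
  have [k xk] := f_refl _ _ cx; have [l yl] := f_refl y b ltac:(by rewrite -cxy).
  have m0 : (0 < cox_label [set x; y]%SET)%N.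
    by apply: leq_trans (cox_label_ge2 xy).
  have : (f x * f y) ^+ (cox_label [set x; y]%SET) = 1.
    have rel : (gen x * gen y) ^+ (cox_label [set x; y]%SET) = 1.
      rewrite -(@cls_relator _ (flatten (nseq (cox_label [set x; y]%SET)
        [:: (x, true); (y, true)]))).
        elim: cox_label => [|n IHn]; first by rewrite expg0 cls_nil.
        by rewrite expgS IHn /= !cls_cons mulgA.
      by right; exists x, y.
    have := congr1 (F \o val a) rel.
    by rewrite (morphXg FaM) (morph1g FaM) FaM.
  rewrite xk yl dihM /= dih_transX dih1 => -[] /eqP.
  rewrite mulrn_eq0 eqn0Ngt m0 /= => /eqP E; congr (_, _); lia.
have f_same := c_conn f_adj.
have [k v0k] := f_refl _ _ cv0; have [l v1l] := f_refl _ _ cv1.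
rewrite addr0 in v0k.
have dvd_ind (S : set dihedral) : S 1 -> (forall x y, S x -> S y -> S (x * y)) ->
    S (f v0) -> S (f v1) -> forall w, S (F (val a w)).
  move=> S1 SM S0 S1' w; have [r <-] := prg_ex w.
  elim: r => [|v r IHr]; first by rewrite prg_nil (morph1g (AutM a)) F1.
  rewrite prg_cons AutM FM; apply: SM => //; rewrite -/(f v).
  case cv : (c v) => [[]|]; last by rewrite f_none.
  - by rewrite (f_same v v1)// ?cv.
  - by rewrite (f_same v v0)// ?cv.
pose q := (l *+ 2 + 1 - k *+ 2)%R.
(* The pairs [(e, m)] with [m] congruent to [0] (or to [2k] if [e] holds) modulo [q] are closed
   under products and contain both reflections. Translation by [1] lies among them, so [q] divides
   [1]. *)
have q1 : q = 1%R \/ q = (-1)%R.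
  have [w Fw] := dihedral_quotient_surj (false, 1%R).
  have := dvd_ind [set g | exists z : int, g.2 = (q * z + if g.1 then k *+ 2 else 0)%R].
  move=> /(_ _ _ _ _ (val a^-1 w)); rewrite (Aut_invKV a) Fw /= => H.
  have [||||z /esym/eqP] := H.
  - by exists 0%R; rewrite mulr0.
  - move=> [e m] [e' m'] [/= z ->] [z' ->]; exists (z + flip e z')%R.
    by rewrite /flip; case: e; case: e' => /=; ring.
  - by exists 0%R; rewrite v0k /=; ring.
  - by exists 1%R; rewrite v1l /q /=; ring.
  rewrite addr0 => /eqP/(congr1 absz); rewrite abszM => /eqP.
  by rewrite muln_eq1 => /andP[/eqP]; lia.
(* This isometry sends [0] to [k] and [1/2] to [k + q/2 = l + 1/2]. *)
exists (q == -1, k)%R; move=> w.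
have [r <-] := prg_ex w; elim: r => [|v r IHr].
  by rewrite prg_nil (morph1g (AutM a)) F1 mulg1 mulgV.
rewrite prg_cons AutM !FM IHr !mulgA; congr (_ * _ * _).
set d := ((q == -1, k)%R : dihedral).
suff -> : F (val a (gen v)) = d * F (gen v) * d^-1 by rewrite mulgVK.
rewrite -/(f v) F_gen; case cv : (c v) => [[]|]; last by rewrite f_none// mulg1 mulgV.
- rewrite (f_same v v1) ?cv// v1l /d dihV !dihM.
  by case: q1 => qE; rewrite qE /=; congr (_, _); move: qE; rewrite /q; lia.
- rewrite (f_same v v0) ?cv// v0k /d dihV !dihM.
  by case: q1 => qE; rewrite qE /=; congr (_, _); lia.
Qed.

End DihedralQuotient.

Lemma dihedral_not_T (R : realType) (Gamma : coxeter_graph)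
    (c : cox_vertex Gamma -> option bool) :
  (forall x y, cox_adj x y ->
    c x = c y \/ (~~ odd (cox_label [set x; y]%SET) /\ (c x = None \/ c y = None))) ->
  (forall f : cox_vertex Gamma -> dihedral,
    (forall x y, cox_adj x y -> c x = c y -> f x = f y) ->
    forall x y, c x = c y -> c x <> None -> f x = f y) ->
  (exists v, c v = Some false) -> (exists v, c v = Some true) ->
  ~ has_property_T R (Aut (coxeter_group Gamma)).
Proof.
move=> c_edge c_conn [v0 cv0] [v1 cv1].
have [F [FM F_gen]] := dihedral_quotient c_edge.
apply: (@inner_mod_not_T R _ _ F FM (dihedral_quotient_surj cv0 cv1 FM F_gen) dihedral
  (fun g h => g * h) half_line _ _ half_line_comm _ _ (@aut_type Gamma) 1).
- exact: mul1g.
- by move=> g h y; rewrite mulgA.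
- by move=> z /dihedral_centerless -> y; rewrite mul1g.
- apply: (@infinite_seq_dihedral _ Posz); first by move=> m n [].
  by move=> n; split=> //; exists (false, Posz n); rewrite mulg1.
- apply: (@infinite_seq_dihedral _ Negz); first by move=> m n [].
  by move=> n; split=> //; exists (false, Negz n); rewrite mulg1.
- exact: finite_finset.
move=> a b /aut_type_conjugating; exact: (gen_conjugating_inner_mod c_conn cv0 cv1 FM F_gen).
Qed.

(** * The four cases *)

Lemma cox_adj_sym (Gamma : coxeter_graph) : symmetric (@cox_adj Gamma).
Proof. by move=> x y; rewrite /cox_adj finset.setUC. Qed.

(** [W] is its own parabolic on all vertices, with [i] and [rho] the identity; the class in [Out]
    serves as key. *)
Lemma finite_Out_not_T (R : realType) (Gamma : coxeter_graph) :
  infinite_set [set: coxeter_group Gamma] ->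
  finite_set [set: Out (coxeter_group Gamma)] ->
  ~ has_property_T R (Aut (coxeter_group Gamma)).
Proof.
move=> infW finOut.
have i_gen v : v \in [set: cox_vertex Gamma]%SET -> exists d, id d = gen v by exists (gen v).
have i_generated d : smallest (@is_subgroup (coxeter_group Gamma))
    [set gen v | v in [set` [set: cox_vertex Gamma]%SET]] d.
  move=> S [[S1 SM SV] genS]; have [l <-] := prg_ex d.
  elim: l => [|v l IHl]; first by rewrite prg_nil.
  by rewrite prg_cons; apply: SM => //; apply: genS; exists v => //=; rewrite finset.in_setT.
have [s sO s_inf] := infinite_reflection_class (fun _ _ => erefl) (@inj_id _)
  i_gen i_generated infW.
apply: (parabolic_not_T (i := id) (fun _ _ => erefl) i_gen sO s_inf
  (rho := id) (key := @Out_class _)).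
- by [].
- by move=> d; exists d.
- exact: sub_finite_set finOut.
- by move=> a b /Out_classP.
Qed.

(** Two components receive the two colours and the others are killed, so every edge is
    monochromatic. *)
Lemma disconnected_not_T (R : realType) (Gamma : coxeter_graph) :
  ~ cox_connected Gamma -> ~ has_property_T R (Aut (coxeter_group Gamma)).
Proof.
move=> /existsNP[v /existsNP[w /negP vw]].
have conn_sym : connect_sym (@cox_adj Gamma) by apply/sym_connect_sym/cox_adj_sym.
pose c u := if connect (@cox_adj Gamma) v u then Some false
  else if connect (@cox_adj Gamma) w u then Some true else None.
have c_adj x y : cox_adj x y -> c x = c y.
  move=> xy; have E u : connect (@cox_adj Gamma) u x = connect (@cox_adj Gamma) u y.
    by rewrite ![connect _ u _]conn_sym; exact/same_connect/connect1.
  by rewrite /c !E.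
apply: (@dihedral_not_T R Gamma c).
- by move=> x y /c_adj; left.
- move=> f f_adj x y cxy cN.
  have /connectP[p xp ->] : connect (@cox_adj Gamma) x y.
    move: cxy cN; rewrite /c.
    case: ifP => [vx|_].
      by case: ifP => [vy|_]; [rewrite -(same_connect conn_sym vx)|case: ifP].
    case: ifP => [wx|//]; case: ifP => // _; case: ifP => // wy _ _.
    by rewrite -(same_connect conn_sym wx).
  elim: p x xp {cxy cN} => [//|z p IHp] x /= /andP[xz zp].
  by rewrite (f_adj _ _ xz (c_adj _ _ xz)) (IHp z).
- by exists v; rewrite /c connect0.
- by exists w; rewrite /c connect0 (negbTE vw).
Qed.

(** The two colour classes are [v] and [w] alone, and every other vertex is killed; each edge
    meeting them has an even label. *)
Lemma even_vertices_not_T (R : realType) (Gamma : coxeter_graph) (v w : cox_vertex Gamma) :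
  v != w -> ~~ cox_adj v w -> even_vertex v -> even_vertex w ->
  ~ has_property_T R (Aut (coxeter_group Gamma)).
Proof.
move=> vw nvw v_even w_even.
pose c u := if u == v then Some false else if u == w then Some true else None.
have even_adj x y : cox_adj x y -> c x <> None -> ~~ odd (cox_label [set x; y]%SET).
  move=> xy; rewrite /c; case: eqP => [xv _|_].
    by apply: v_even => //; rewrite xv !inE eqxx.
  by case: eqP => // xw _; apply: w_even => //; rewrite xw !inE eqxx.
apply: (@dihedral_not_T R Gamma c).
- move=> x y xy; case cx : (c x) => [b|]; case cy : (c y) => [b'|]; last by left.
  + left; move: cx cy xy; rewrite /c.
    have [->|_] := eqVneq x v; have [->|_] := eqVneq y v.
    * by move=> <- <-.
    * by case: eqP => [->|//] _ _; rewrite (negbTE nvw).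
    * by case: eqP => [->|//] _ _; rewrite cox_adj_sym (negbTE nvw).
    * by case: eqP => // _ <-; case: eqP => // _ <-.
  + by right; split; [apply: even_adj => //; rewrite cx|right].
  + right; split; last by left.
    by rewrite finset.setUC even_adj// 1?cox_adj_sym// cy.
- move=> f _ x y; rewrite /c.
  have [->|_] := eqVneq x v; have [->|_] := eqVneq y v => //; try by case: eqP.
  by have [->|_] := eqVneq x w; have [->|_] := eqVneq y w.
- by exists v; rewrite /c eqxx.
- by exists w; rewrite /c eqxx eq_sym (negbTE vw).
Qed.

(** * Retraction onto a parabolic subgroup with even boundary edges *)

Section EvenParabolic.
Variables (Gamma : coxeter_graph) (Omega : {set cox_vertex Gamma}).
Hypothesis cross_even : forall v w : cox_vertex Gamma,
  v \in Omega -> w \notin Omega -> cox_adj v w -> ~~ odd (cox_label [set v; w]%SET).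
Local Notation W := (coxeter_group Gamma).
Local Notation P := (special_parabolic Omega).
Local Notation inc := (val : P -> W).

Lemma parabolic_valM : {morph inc : x y / x * y}. Proof. by []. Qed.

Lemma parabolic_generated (d : P) :
  smallest (@is_subgroup W) [set gen v | v in [set` Omega]] (inc d).
Proof. by case: d => x xP; exact/set_mem. Qed.

Lemma parabolic_gen v : v \in Omega -> exists d : P, inc d = gen v.
Proof.
move=> vO; have gv : in_generated [set gen v | v in [set` Omega]] (gen v).
  by apply/mem_set => S [_]; apply; exists v.
by exists (Sub (gen v) gv).
Qed.

(** Killing the vertices outside [Omega] respects the relators: one from a crossing edge becomes an
    even power of an involution. *)
Lemma parabolic_retraction : exists rho : W -> P,
  [/\ {morph rho : x y / x * y}, cancel inc rho & forall v, v \notin Omega -> rho (gen v) = 1].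
Proof.
have [|g gE] := @choice _ _ (fun v (d : P) => inc d = if v \in Omega then gen v else 1).
  move=> v; by case: ifP => [/parabolic_gen|_] //; exists 1.
have g_out v : v \notin Omega -> g v = 1.
  by move=> vO; apply: val_inj; rewrite gE (negbTE vO).
have g_sq v : g v * g v = 1.
  apply: val_inj; rewrite parabolic_valM gE; case: ifP => _; last by rewrite mul1g.
  by rewrite gen_sq.
have even_pow v m : ~~ odd m -> g v ^+ m = 1.
  move=> /even_halfK <-; elim: m./2 => [|n IHn]; first by rewrite expg0.
  by rewrite doubleS !expgS IHn mulg1 g_sq.
have [|rho [rhoM rhoE]] := @presented_lift _ (@cox_relators Gamma) P g.
  move=> r rr; case: (rr) => [[v ->]|[x [y [xy rE]]]].
    by rewrite /word_eval !big_cons big_nil mulg1 g_sq.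
  have evalE m : word_eval g (flatten (nseq m [:: (x, true); (y, true)])) = (g x * g y) ^+ m.
    elim: m => [|m IHm]; first by rewrite /word_eval big_nil.
    by rewrite expgS -IHm /word_eval /= !big_cons /= mulgA.
  rewrite rE evalE.
  have [xO|xO] := boolP (x \in Omega); have [yO|yO] := boolP (y \in Omega).
  - apply: val_inj; rewrite (morphXg parabolic_valM) parabolic_valM !gE xO yO.
    rewrite -[RHS](cls_relator rr) rE; elim: cox_label => [|n IHn].
      by rewrite expg0 cls_nil.
    by rewrite expgS IHn /= !cls_cons mulgA.
  - by rewrite (g_out y)// mulg1 even_pow// cross_even.
  - by rewrite (g_out x)// mul1g even_pow// finset.setUC cross_even// cox_adj_sym.
  - by rewrite !g_out// mulg1 expg1n.
exists rho; split=> //; last by move=> v vO; rewrite rhoE g_out.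
move=> d; apply: val_inj.
pose S : set W := [set x | inc (rho x) = x].
suff : S (inc d) by [].
apply: (parabolic_generated d) => {d}; split; first split.
- by rewrite /S /mkset (morph1g rhoM).
- by move=> x y; rewrite /S /mkset => xE yE; rewrite rhoM parabolic_valM xE yE.
- by move=> x; rewrite /S /mkset => xE; rewrite (morphVg rhoM) (morphVg parabolic_valM) xE.
- by move=> _ [v vO <-]; rewrite /S /mkset rhoE gE ifT.
Qed.

Variable rho : W -> P.
Hypotheses (rhoM : {morph rho : x y / x * y}) (incK : cancel inc rho)
  (rho_out : forall v, v \notin Omega -> rho (gen v) = 1).

Lemma rho_gen_in v : v \in Omega -> inc (rho (gen v)) = gen v.
Proof. by move=> /parabolic_gen[d <-]; rewrite incK. Qed.

(** A vertex outside [Omega] is killed by [rho], and so is its image under [a], a conjugate of it.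
    Thus [a] preserves the kernel of [rho]. *)
Lemma retraction_conjugating (a : Aut W) : gen_conjugating a ->
  forall x, rho (val a x) = rho (val a (inc (rho x))).
Proof.
move=> a_conj x; have [l <-] := prg_ex x; elim: l => [|v l IHl].
  by rewrite prg_nil (morph1g rhoM) (morph1g parabolic_valM).
rewrite prg_cons rhoM parabolic_valM !AutM !rhoM IHl; congr (_ * _).
have [vO|vO] := boolP (v \in Omega); first by rewrite rho_gen_in.
rewrite rho_out// (morph1g parabolic_valM) (morph1g (AutM a)) (morph1g rhoM).
have [y ->] := a_conj v.
by rewrite !rhoM (morphVg rhoM) rho_out// mulg1 mulgV.
Qed.

Lemma gen_conjugatingV (a : Aut W) : gen_conjugating a -> gen_conjugating a^-1.
Proof.
move=> a_conj v; have [x ax] := a_conj v; exists (val a^-1 x^-1).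
have E := congr1 (val a^-1) ax; rewrite (Aut_invK a) !AutM (morphVg (AutM _)) in E.
by rewrite (morphVg (AutM _)) invgK [in RHS]E !mulgA mulVg mul1g mulgVK.
Qed.

Lemma retraction_aut_subproof (a : Aut W) : gen_conjugating a ->
  is_automorphism (fun d : P => rho (val a (inc d))).
Proof.
move=> a_conj; apply/asboolP; split=> [x y|]; first by rewrite AutM rhoM.
exists (fun d : P => rho (val a^-1 (inc d))) => d.
  rewrite -(retraction_conjugating (gen_conjugatingV a_conj)).
  by rewrite (Aut_invK a) incK.
by rewrite -(retraction_conjugating a_conj) (Aut_invKV a) incK.
Qed.

Definition retraction_aut (a : Aut W) : Aut P :=
  match pselect (gen_conjugating a) with
  | left a_conj => Sub _ (retraction_aut_subproof a_conj)
  | right _ => 1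
  end.

Lemma retraction_autE a : gen_conjugating a ->
  forall x, val (retraction_aut a) (rho x) = rho (val a x).
Proof.
move=> a_conj x; rewrite /retraction_aut; case: pselect => // a_conj'.
by rewrite SubK -retraction_conjugating.
Qed.

(** Only generator-conjugating automorphisms descend to [P], so [a] is first divided by a chosen
    representative of its type; the key adds the outer class of the result. *)
Lemma even_parabolic_key : finite_set [set: Out P] ->
  exists key : Aut W -> {ffun cox_vertex Gamma -> {set cox_vertex Gamma}} * Out P,
    finite_set (range key) /\
    forall a b, key a = key b -> inner_mod rho (a^-1 * b).
Proof.
move=> finOut.
pose rep a : Aut W := xget 1 [set b | aut_type b = aut_type a].
have repP a : aut_type (rep a) = aut_type a.
  by rewrite /rep; case: xgetP => // /(_ a) [].
have rep_conj a : gen_conjugating ((rep a)^-1 * a) by apply/aut_type_conjugating/repP.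
pose key (a : Aut W) := (aut_type a, Out_class (retraction_aut ((rep a)^-1 * a))).
exists key; split.
  have finT : finite_set [set: {ffun cox_vertex Gamma -> {set cox_vertex Gamma}}].
    exact: finite_finset.
  by apply: sub_finite_set (finite_setX finT finOut) => p _; split.
move=> a b [tab /Out_classP[g gE]]; exists g => x.
have rab : rep b = rep a by rewrite /rep tab.
have := rep_conj a; have := rep_conj b; rewrite rab in gE *.
set a' := (rep a)^-1 * a in gE *; set b' := (rep a)^-1 * b in gE * => b_conj a_conj.
have -> : a^-1 * b = a'^-1 * b' by rewrite /a' /b' invgM invgK mulgA mulgK.
(* With [x] in this form the inverses cancel, and [retraction_autE] is needed only for [a'] and
   [b']. *)
have [y ->] : exists y, x = val b'^-1 (val a' y).
  exists (val a'^-1 (val b' x)); rewrite (Aut_invKV a').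
  by rewrite (Aut_invK b').
rewrite Aut_mulE (Aut_invKV b') (Aut_invK a').
have := gE (rho (val b'^-1 (val a' y))).
rewrite Aut_mulE (retraction_autE b_conj) (Aut_invKV b') -(retraction_autE a_conj).
by rewrite (Aut_invK (retraction_aut a')).
Qed.

End EvenParabolic.

Theorem corollary1p9 (R : realType) (Gamma : coxeter_graph) :
  infinite_set [set: coxeter_group Gamma] ->
  [\/ finite_set [set: Out (coxeter_group Gamma)],
      ~ cox_connected Gamma,
      exists v w : cox_vertex Gamma,
        [/\ v != w, ~~ cox_adj v w, even_vertex v & even_vertex w]
    | exists Omega : {set cox_vertex Gamma},
        [/\ infinite_set [set: special_parabolic Omega],
            finite_set [set: Out (special_parabolic Omega)]
          & forall v w : cox_vertex Gamma,
              v \in Omega -> w \notin Omega -> cox_adj v w ->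
              ~~ odd (cox_label [set v; w]%SET)]] ->
  ~ has_property_T R (Aut (coxeter_group Gamma)).
Proof.
move=> infW; case.
- exact: finite_Out_not_T.
- exact: disconnected_not_T.
- by move=> [v [w [vw nvw v_even w_even]]]; exact: even_vertices_not_T vw nvw v_even w_even.
move=> [B [infP finP cross_even]].
have [rho [rhoM incK rho_out]] := parabolic_retraction cross_even.
have [key [fin keyP]] := even_parabolic_key rhoM incK rho_out finP.
have [s sO s_inf] := infinite_reflection_class (@parabolic_valM _ B) val_inj
  (@parabolic_gen _ B) (@parabolic_generated _ B) infP.
apply: (parabolic_not_T (@parabolic_valM _ B) (@parabolic_gen _ B) sO s_inf
  rhoM _ fin keyP).
by move=> d; exists (val d).
Qed.
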